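(* Let $\Gamma$ be a convex lattice configuration in $\mathfrak B_d$ contained in an apartment, and let $0<r<d$. The rank vector $\Phi$ is constant on each Bruhat stratum $S_{\mathbf x}$ of $LG_r(\Gamma)_0$, $\mathbf x\in\mathbf{adm}_r(\Gamma)$, and points in different strata $S_{\mathbf x}$ have distinct rank vectors. Equivalently, the Bruhat stratification of $LG_r(\Gamma)_0$ agrees with the rank-vector stratification of $\mathrm{Gr}(\mathbf r,M_\Gamma)$, $\mathbf r=(r,\dots,r)$.
   Context: SETTING. $R$ is a discrete valuation ring with fraction field $K$, uniformizer $\pi$ and algebraically closed residue field $\kappa$; $0<r<d$ are integers. A lattice in $K^d$ is a free $R$-submodule $L\subset K^d$ with $L\otimes_RK\to K^d$ an isomorphism; $[L]$ is its homothety class. Distinct classes are adjacent if they have representatives with $\pi L_1\subset L_2\subset L_1$; $\mathfrak B_d$ is the flag complex of homothety classes under adjacency. A convex lattice configuration is a finite nonempty set $\Gamma$ of classes such that $[L_1\cap L_2]\in\Gamma$ for any representatives $L_1,L_2$ of two members of $\Gamma$. It is contained in an apartment if there is a basis $e_1,\dots,e_d$ of $K^d$ such that all its classes have the form $[\langle\pi^{c_1}e_1,\dots,\pi^{c_d}e_d\rangle]$. Write $\Gamma=\{[L_v]\}_v$ with fixed representatives and identify $\Gamma$ with the index set. For $u,v\in\Gamma$ let $n_{u,v}$ be the minimal integer with $\pi^{n_{u,v}}L_u\subset L_v$, put $\overline L_v=L_v/\pi L_v$, and let $f_{u,v}:\overline L_u\to\overline L_v$ be induced by multiplication by $\pi^{n_{u,v}}$.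 QUIVER AND LINKED GRASSMANNIAN. $Q(\Gamma)'$ has vertex set $\Gamma$ and one arrow $(u,v)$ for each ordered pair $u\ne v$. $Q(\Gamma)$ is obtained from it by removing every arrow $(u,v)$ for which some path of length $\ge2$ from $u$ to $v$ in $Q(\Gamma)'$ has composite map equal to $f_{u,v}$. $M_\Gamma=(\overline L_v)_v$ is the representation of $Q(\Gamma)$ with maps $f_{u,v}$. $LG_r(\Gamma)$ is the projective $R$-scheme whose $T$-points are collections of rank-$r$ sub-bundles $E_v\subset L_v\otimes\mathcal O_T$ such that for every inclusion $\pi^k:L_u\hookrightarrow L_v$ ($k\in\mathbb Z$) the induced map sends $E_u$ into $E_v$. The points of its special fiber $LG_r(\Gamma)_0$ are the sub-representations of $M_\Gamma$ of dimension $\mathbf r$, i.e. it is set-theoretically the quiver Grassmannian $\mathrm{Gr}(\mathbf r,M_\Gamma)$. RANK VECTORS. For a sub-representation $M=(U_v)_v$, $\Phi(M)=(\dim f_{u,v}(U_u))_{u,v\in\Gamma}$; the rank-vector strata are the fibers of $\Phi$. BRUHAT STRATIFICATION. For $a\in\mathbb Z^d$ put $L(a)=\langle\pi^{-a(1)}e_1,\dots,\pi^{-a(d)}e_d\rangle$. $\widetilde W=\mathbb S_d\ltimes\mathbb Z^d$ is the group of transformations $(\sigma,v):a\mapsto(a(\sigma^{-1}(1)),\dots,a(\sigma^{-1}(d)))+v$ of $\mathbb Z^d$; $W_a\subset\widetilde W$ consists of those with $\sum_kv(k)=0$. Let $\tau_j$ $(j\in\mathcal J)$ be the maximal simplices of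 the complex spanned by $\Gamma$ (maximal sets of pairwise adjacent classes). Choose representatives $L_v=L(a_v)$ such that those of the vertices of each $\tau_j$ can be ordered as $L_0\subset L_1\subset\dots\subset\pi^{-1}L_0$. Let $W_j$ (resp. $W_{j,j'}$) be the subgroup of $W_a$ fixing $a_v$ for all $v\in\tau_j$ (resp. $v\in\tau_j\cap\tau_{j'}$). $\mathbf{adm}_r(\Gamma)$ is the set of $\Gamma$-admissible collections of size $r$: tuples $\mathbf x=(h_jW_j)_{j\in\mathcal J}$, $h_j\in\widetilde W$, with $a_v\le h_j\cdot a_v\le a_v+(1,\dots,1)$ coordinatewise and $\sum_k (h_j\cdot a_v)(k)-\sum_k a_v(k)=r$ for $v\in\tau_j$, and $W_{j,j'}h_jW_{j,j'}=W_{j,j'}h_{j'}W_{j,j'}$ for all $j,j'$. For $a\in\mathbb Z^d$ let $\Lambda(a)=\langle t^{-a(1)}e_1,\dots,t^{-a(d)}e_d\rangle_{\kappa[[t]]}\subset\kappa((t))^d$; identify $\overline L_v$ with $\Lambda(a_v)/t\Lambda(a_v)$ by sending the class of $\pi^{-a_v(k)}e_k$ to that of $t^{-a_v(k)}e_k$. Let $P_j\subset\mathrm{SL}_d(\kappa((t)))$ be the common stabilizer of the $\Lambda(a_v)$, $v\in\tau_j$. The Bruhat stratum $S_{\mathbf x}$ is the set of points $(E_v)_v$ of $LG_r(\Gamma)_0$ such that for each $j$ the tuple $(t^{-1}\widetilde E_v)_{v\in\tau_j}$ lies in the $P_j$-orbit of $(\Lambda(h_j\cdot a_v))_{v\in\tau_j}$,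 where $\widetilde E_v\subset\Lambda(a_v)$ is the preimage of $E_v$. $S_{\mathbf x}$ depends only on the double cosets $(W_jh_jW_j)_j$. *)

(* Defs.v *)
From HB Require Import structures.
From mathcomp Require Import all_boot all_order all_fingroup all_algebra.
From mathcomp Require Import boolp classical_sets cardinality.

Set Implicit Arguments.
Unset Strict Implicit.
Unset Printing Implicit Defensive.

Import Order.TTheory GRing.Theory Num.Theory.

Local Open Scope classical_set_scope.
Local Open Scope ring_scope.

Notation "x %:F" := (@FracField.tofrac _ x) : ring_scope.

Record powerSeries (F : fieldType) := PowerSeries { coefs :> nat -> F }.

Section PowerSeriesRing.
Variable F : fieldType.
Local Notation S := (powerSeries F).
Implicit Types s t u : S.

HB.instance Definition _ := gen_eqMixin S.
HB.instance Definition _ := gen_choiceMixin S.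

Lemma powerSeriesP s t : (forall n, s n = t n) -> s = t.
Proof. by case: s t => [f] [g] /= h; congr PowerSeries; apply/funext. Qed.

Definition ps_zero : S := PowerSeries (fun=> 0).
Definition ps_opp s : S := PowerSeries (fun n => - s n).
Definition ps_add s t : S := PowerSeries (fun n => s n + t n).

Fact ps_addA : associative ps_add.
Proof. by move=> s t u; apply: powerSeriesP => n /=; rewrite addrA. Qed.
Fact ps_addC : commutative ps_add.
Proof. by move=> s t; apply: powerSeriesP => n /=; rewrite addrC. Qed.
Fact ps_add0 : left_id ps_zero ps_add.
Proof. by move=> s; apply: powerSeriesP => n /=; rewrite add0r. Qed.
Fact ps_addN : left_inverse ps_zero ps_opp ps_add.
Proof. by move=> s; apply: powerSeriesP => n /=; rewrite addNr. Qed.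

HB.instance Definition _ :=
  GRing.isZmodule.Build S ps_addA ps_addC ps_add0 ps_addN.

Definition ps_one : S := PowerSeries (fun n => (n == 0%N)%:R).
Definition ps_mul s t : S :=
  PowerSeries (fun n => \sum_(i < n.+1) s i * t (n - i)%N).

Let trunc n s : {poly F} := \poly_(i < n.+1) s i.

Let coef_trunc n s k : (k <= n)%N -> (trunc n s)`_k = s k.
Proof. by move=> kn; rewrite coef_poly ltnS kn. Qed.

Let coef_ps_mul n (p q : {poly F}) s t :
    (forall k, (k <= n)%N -> p`_k = s k) ->
    (forall k, (k <= n)%N -> q`_k = t k) ->
  forall k, (k <= n)%N -> (p * q)`_k = ps_mul s t k.
Proof.
move=> ps qt k kn; rewrite coefM /=; apply: eq_bigr => i _.
rewrite ps ?qt //; first exact: leq_trans (leq_subr _ _) kn.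
by apply: leq_trans kn; rewrite -ltnS.
Qed.

Fact ps_mulA : associative ps_mul.
Proof.
move=> s t u; apply: powerSeriesP => n.
have T v k : (k <= n)%N -> (trunc n v)`_k = v k by exact: coef_trunc.
rewrite -(coef_ps_mul (T s) (coef_ps_mul (T t) (T u)) (leqnn n)) mulrA.
exact: coef_ps_mul (coef_ps_mul (T s) (T t)) (T u) _ (leqnn n).
Qed.

Fact ps_mulC : commutative ps_mul.
Proof.
move=> s t; apply: powerSeriesP => n.
have T v k : (k <= n)%N -> (trunc n v)`_k = v k by exact: coef_trunc.
rewrite -(coef_ps_mul (T s) (T t) (leqnn n)) mulrC.
exact: coef_ps_mul (T t) (T s) _ (leqnn n).
Qed.

Fact ps_mul1 : left_id ps_one ps_mul.
Proof.
move=> s; apply: powerSeriesP => n /=.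
rewrite big_ord_recl /= mul1r subn0 big1 ?addr0 // => i _.
by rewrite mul0r.
Qed.

Fact ps_mulDl : left_distributive ps_mul ps_add.
Proof.
move=> s t u; apply: powerSeriesP => n /=.
by rewrite -big_split /=; apply: eq_bigr => i _; rewrite mulrDl.
Qed.

Fact ps_one_neq0 : ps_one != 0.
Proof.
by apply/eqP => /(congr1 (fun s : S => s 0%N)) /eqP; rewrite /= oner_eq0.
Qed.

HB.instance Definition _ :=
  GRing.Zmodule_isComNzRing.Build S ps_mulA ps_mulC ps_mul1 ps_mulDl
    ps_one_neq0.

Definition ps_unit : {pred S} := fun s => `[< exists t, t * s = 1 >].
Definition ps_inv s : S :=
  if s \in ps_unit then xget s [set t | t * s = 1] else s.

Fact ps_mulVx : {in ps_unit, left_inverse 1 ps_inv *%R}.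
Proof.
move=> s us; rewrite /ps_inv us.
by apply: (xgetPex s (P := [set t | t * s = 1])); apply/asboolP.
Qed.
Fact ps_unitPl s t : t * s = 1 -> ps_unit s.
Proof. by move=> ts; apply/asboolP; exists t. Qed.
Fact ps_invr_out : {in [predC ps_unit], ps_inv =1 id}.
Proof. by move=> s; rewrite inE /ps_inv => /negbTE ->. Qed.

HB.instance Definition _ :=
  GRing.ComNzRing_hasMulInverse.Build S ps_mulVx ps_unitPl ps_invr_out.

Let ps_order s : s != 0 ->
  exists2 n, s n != 0 & forall i, (i < n)%N -> s i = 0.
Proof.
move=> s0; have [[n sn]|h] := pselect (exists n, s n != 0); last first.
  case/eqP: s0; apply: powerSeriesP => n; apply: contrapT => sn.
  by apply: h; exists n; apply/eqP.
case: (@ex_minnP (fun n => s n != 0) (ex_intro _ n sn)) => m sm mmin.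
exists m => // i im; apply/eqP; apply: contraLR im => si.
by rewrite -leqNgt mmin.
Qed.

Fact ps_mulf_eq0 s t : s * t = 0 -> (s == 0) || (t == 0).
Proof.
move=> st0; case: (eqVneq s 0) => //= /ps_order[m sm sl].
case: (eqVneq t 0) => //= /ps_order[n tn tl].
have /eqP := congr1 (fun s : S => s (m + n)%N) st0.
rewrite /=.
have mlt : (m < (m + n).+1)%N by rewrite ltnS leq_addr.
rewrite (bigD1 (Ordinal mlt)) //= addKn big1 ?addr0.
  by rewrite mulf_eq0 (negbTE sm) (negbTE tn).
move=> i /eqP im; have [il|gi] := ltnP i m; first by rewrite sl ?mul0r.
rewrite tl ?mulr0 // ltn_subLR; last by rewrite -ltnS.
rewrite ltn_add2r ltn_neqAle gi andbT.
by apply: contra_notN im => /eqP mi; apply: val_inj.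
Qed.

HB.instance Definition _ := GRing.ComUnitRing_isIntegral.Build S ps_mulf_eq0.

Definition ps_var : S := PowerSeries (fun n => (n == 1%N)%:R).
End PowerSeriesRing.


Section Lattices.
Variables (R : idomainType) (d : nat).
Local Notation K := {fraction R}.

(* Vectors of K^d are rows; linear maps act by right multiplication. *)
Definition lspan (b : 'M[K]_d) : set 'rV[K]_d :=
  [set map_mx (@FracField.tofrac R) c *m b | c in [set: 'rV[R]_d]].

Definition is_lattice (L : set 'rV[K]_d) : Prop :=
  exists2 b : 'M[K]_d, b \in unitmx & L = lspan b.

Definition dilate (c : K) (L : set 'rV[K]_d) : set 'rV[K]_d :=
  [set c *: x | x in L].

Definition homothety_class (L : set 'rV[K]_d) : set (set 'rV[K]_d) :=
  [set dilate c L | c in [set c : K | c != 0]].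

Definition convex_lattice_configuration (Gamma : set (set (set 'rV[K]_d))) :=
  [/\ finite_set Gamma,
      Gamma !=set0,
      forall C, Gamma C -> exists2 L, is_lattice L & C = homothety_class L &
      forall C1 C2 L1 L2, Gamma C1 -> Gamma C2 -> C1 L1 -> C2 L2 ->
        Gamma (homothety_class (L1 `&` L2))].

Variable pi : R.

Definition adjacent (C1 C2 : set (set 'rV[K]_d)) : Prop :=
  C1 <> C2 /\
  exists L1 L2, [/\ C1 L1, C2 L2, dilate pi%:F L1 `<=` L2 & L2 `<=` L1].

(* The vector pi ^ (- a k) e_k, where e_k is the k-th row of e. *)
Definition scaled_basis (e : 'M[K]_d) (a : 'rV[int]_d) (k : 'I_d) : 'rV[K]_d :=
  pi%:F ^ (- a 0 k) *: row k e.

Definition apartment_lattice (e : 'M[K]_d) (a : 'rV[int]_d) : set 'rV[K]_d :=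
  lspan (\matrix_(k < d) scaled_basis e a k).

Definition in_apartment (Gamma : set (set (set 'rV[K]_d))) (e : 'M[K]_d) :=
  forall C, Gamma C -> exists a, C = homothety_class (apartment_lattice e a).

(* The minimal n with pi ^ n L ⊂ L'. *)
Definition min_exponent (L L' : set 'rV[K]_d) : int :=
  xget 0 [set n : int | dilate (pi%:F ^ n) L `<=` L' /\
    forall m : int, dilate (pi%:F ^ m) L `<=` L' -> (n <= m)%R].

End Lattices.

(* R is the valuation ring of a discrete valuation v of its fraction field
   (v is only relevant on nonzero elements) and v pi = 1. *)
Definition dvr_with_uniformizer (R : idomainType) (pi : R) : Prop :=
  pi != 0 /\
  exists v : {fraction R} -> int,
    [/\ forall x y, x != 0 -> y != 0 -> v (x * y) = v x + v y,
        forall x y, x != 0 -> y != 0 -> x + y != 0 ->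
          Num.min (v x) (v y) <= v (x + y),
        forall x, x != 0 -> (exists s : R, x = s%:F) <-> 0 <= v x &
        v pi%:F = 1].

(* res identifies kappa with the residue field R / (pi). *)
Definition residue_map (R : idomainType) (pi : R) (kappa : fieldType)
    (res : {rmorphism R -> kappa}) : Prop :=
  (forall y, exists x, res x = y) /\
  (forall x, res x = 0 <-> exists y, x = pi * y).

Section Reduction.
Variables (R : idomainType) (kappa : fieldType) (res : {rmorphism R -> kappa}).
Variables (pi : R) (d : nat).
Local Notation K := {fraction R}.

(* A realization of the kappa-vector space L / pi L; quot_map is meaningful
   only on L. *)
Record lattice_quotient (L : set 'rV[K]_d) := LatticeQuotient {
  quot_space :> vectType kappa;
  quot_map : 'rV[K]_d -> quot_space;
  quot_mapD : forall x y, L x -> L y ->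
    quot_map (x + y) = quot_map x + quot_map y;
  quot_mapZ : forall (c : R) x, L x ->
    quot_map (c%:F *: x) = res c *: quot_map x;
  quot_map_surj : forall y, exists2 x, L x & quot_map x = y;
  quot_map_ker : forall x, L x -> quot_map x = 0 <-> dilate pi%:F L x
}.

(* The map L / pi L -> L' / pi L' induced by multiplication by pi ^ n; see
   induced_mapE. *)
Definition induced_map (n : int) (L L' : set 'rV[K]_d)
    (A : lattice_quotient L) (B : lattice_quotient L') : 'Hom(A, B) :=
  linfun (fun y : A => quot_map B
    (pi%:F ^ n *: xget 0 [set x | L x /\ quot_map A x = y])).

Lemma induced_mapE n L L' (A : lattice_quotient L) (B : lattice_quotient L') x :
    (forall y, exists c, res c = y) -> is_lattice L ->
    dilate (pi%:F ^ n) L `<=` L' -> L x ->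
  induced_map n A B (quot_map A x) = quot_map B (pi%:F ^ n *: x).
Proof.
move=> res_surj [b _ Lb] nLL' Lx.
have LD y z : L y -> L z -> L (y + z).
  rewrite Lb => -[c _ <-] [c' _ <-]; exists (c + c') => //.
  by rewrite map_mxD mulmxDl.
have LZ (c : R) y : L y -> L (c%:F *: y).
  rewrite Lb => -[c' _ <-]; exists (c *: c') => //.
  by rewrite map_mxZ scalemxAl.
have LB y z : L y -> L z -> L (y - z).
  by move=> Ly Lz; apply: LD => //; rewrite -scaleN1r -tofrac1 -tofracN; apply: LZ.
pose lift (y : A) := xget 0 [set x | L x /\ quot_map A x = y].
have liftP y : L (lift y) /\ quot_map A (lift y) = y.
  apply: (xgetPex 0 (P := [set x | L x /\ quot_map A x = y])).
  by have [z] := quot_map_surj y; exists z.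
have L'n y : L y -> L' (pi%:F ^ n *: y) by move=> Ly; apply: nLL'; exists y.
have key y z : L y -> L z -> quot_map A y = quot_map A z ->
    quot_map B (pi%:F ^ n *: y) = quot_map B (pi%:F ^ n *: z).
  move=> Ly Lz yz.
  have: dilate pi%:F L (y - z).
    apply/(@quot_map_ker _ A); first exact: LB.
    rewrite -scaleN1r -tofrac1 -tofracN quot_mapD //; last exact: LZ.
    by rewrite quot_mapZ // rmorphN1 scaleN1r yz subrr.
  case=> w Lw wE; rewrite -[y](subrK z) -wE scalerDr scalerA mulrC -scalerA.
  rewrite quot_mapD; [|by rewrite scalerA mulrC -scalerA; apply/L'n/LZ|exact: L'n].
  rewrite [X in X + _](_ : _ = 0) ?add0r //.
  apply/(@quot_map_ker _ B); last by exists (pi%:F ^ n *: w) => //; exact: L'n.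
  by rewrite scalerA mulrC -scalerA; apply: L'n; apply: LZ.
pose g (y : A) := quot_map B (pi%:F ^ n *: lift y).
have g_lin : linear g.
  move=> c y z; have [c' <-] := res_surj c.
  have [Ly qy] := liftP y; have [Lz qz] := liftP z.
  rewrite /g -quot_mapZ; last exact: L'n.
  rewrite scalerA mulrC -scalerA -quot_mapD; [|by apply/L'n/LZ|exact: L'n].
  rewrite -scalerDr; apply: key; [by case: (liftP (res c' *: y + z))| |].
    by apply: LD => //; apply: LZ.
  rewrite quot_mapD ?quot_mapZ ?qy ?qz //; last exact: LZ.
  by case: (liftP (res c' *: y + z)).
pose glin := GRing.isLinear.Build _ _ _ _ g g_lin.
pose G : {linear A -> B} := HB.pack g glin.
rewrite /induced_map -/g (lfunE G) /=.
by apply: key => //; case: (liftP (quot_map A x)).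
Qed.

Lemma lattice_quotient_exists (L : set 'rV[K]_d) :
  residue_map pi res -> is_lattice L -> inhabited (lattice_quotient L).
Proof.
move=> [res_surj res_ker] [b b_unit Lb].
pose q (x : 'rV[K]_d) : 'rV[kappa]_d :=
  map_mx res (xget 0 [set c : 'rV[R]_d | map_mx (@FracField.tofrac R) c *m b = x]).
have tofrac_inj : injective (@FracField.tofrac R).
  by move=> y z /eqP; rewrite tofrac_eq => /eqP.
have qE c : q (map_mx (@FracField.tofrac R) c *m b) = map_mx res c.
  rewrite /q; set P := [set _ | _].
  have xc : P (xget 0 P) by apply: xgetPex; exists c.
  rewrite (_ : xget 0 P = c) //.
  apply/matrixP => i j; apply: tofrac_inj.
  by have := congr1 (fun M => (M *m invmx b) i j) xc; rewrite !mulmxK // !mxE.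
constructor; apply: (@LatticeQuotient L 'rV[kappa]_d q); rewrite ?Lb.
- by move=> _ _ [x _ <-] [y _ <-]; rewrite -mulmxDl -map_mxD !qE map_mxD.
- by move=> c _ [x _ <-]; rewrite scalemxAl -map_mxZ !qE map_mxZ.
- move=> y; pose c := \row_j xget 0 [set z | res z = y 0 j].
  exists (map_mx (@FracField.tofrac R) c *m b); first by exists c.
  rewrite qE; apply/rowP => j; rewrite !mxE.
  exact: (xgetPex 0 (P := [set z | res z = y 0 j]) (res_surj _)).
- move=> _ [x _ <-]; rewrite qE; split=> [x0|[_ [z _ <-]]]; last first.
    rewrite scalemxAl -map_mxZ => /(congr1 (mulmx^~ (invmx b))).
    rewrite !mulmxK // => /matrixP h; apply/matrixP => i j.
    have := h i j; rewrite !mxE => /tofrac_inj <-.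
    by apply/res_ker; exists (z i j).
  have h j : exists y, x 0 j = pi * y.
    by apply/res_ker; have /rowP/(_ j) := x0; rewrite !mxE.
  pose z := \row_j xget 0 [set y | x 0 j = pi * y].
  exists (map_mx (@FracField.tofrac R) z *m b); first by exists z.
  rewrite scalemxAl -map_mxZ; congr (map_mx _ _ *m b); apply/rowP => j.
  by rewrite !mxE -(xgetPex 0 (P := [set y | x 0 j = pi * y]) (h j)).
Qed.

End Reduction.

Section Quiver.
Variables (R : idomainType) (kappa : fieldType) (res : {rmorphism R -> kappa}).
Variables (pi : R) (d : nat) (V : finType) (L : V -> set 'rV[{fraction R}]_d).
Variable (Lbar : forall v, lattice_quotient res pi (L v)).

Definition transition (u v : V) : 'Hom(Lbar u, Lbar v) :=
  induced_map (min_exponent pi (L u) (L v)) (Lbar u) (Lbar v).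

(* Composite of the transition maps along the path u :: p. *)
Fixpoint path_map (u : V) (p : seq V) : 'Hom(Lbar u, Lbar (last u p)) :=
  if p is w :: p' then (path_map w p' \o transition u w)%VF else \1%VF.

Definition quiver_arrow (u v : V) : Prop :=
  u != v /\
  ~ exists p : seq V,
      [/\ (2 <= size p)%N, path (fun x y => x != y) u p, v = last u p &
          path_map u p = transition u (last u p)].

Definition dim_vector_const (r : nat) (E : forall v, {vspace Lbar v}) : Prop :=
  forall v, \dim (E v) = r.

Definition quiver_grassmannian (r : nat) : set (forall v, {vspace Lbar v}) :=
  [set E | dim_vector_const r E /\
    forall u v, quiver_arrow u v -> (transition u v @: E u <= E v)%VS].

(* The kappa-points of the special fiber of LG_r. *)
Definition linked_grassmannian0 (r : nat) : set (forall v, {vspace Lbar v}) :=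
  [set E | dim_vector_const r E /\
    forall u v (k : int), dilate (pi%:F ^ k) (L u) `<=` L v ->
      (induced_map k (Lbar u) (Lbar v) @: E u <= E v)%VS].

Definition rank_vector (E : forall v, {vspace Lbar v}) : V -> V -> nat :=
  fun u v => \dim (transition u v @: E u)%VS.

Definition adjacentb (u v : V) : bool :=
  `[< adjacent pi (homothety_class (L u)) (homothety_class (L v)) >].

Definition is_simplex (tau : {set V}) : bool :=
  [forall u in tau, forall v in tau, (u != v) ==> adjacentb u v].

Definition maximal_simplex : predArgType :=
  {tau : {set V} | maxset is_simplex tau}.

Definition adapted_representatives : Prop :=
  forall tau : maximal_simplex, exists v0 s,
    [/\ perm_eq (v0 :: s) (enum (val tau)),
        path (fun u v => `[< L u `<=` L v >]) v0 s &
        L (last v0 s) `<=` dilate pi%:F^-1 (L v0)].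

End Quiver.

Arguments quiver_grassmannian {R kappa res pi d V L} Lbar r.
Arguments linked_grassmannian0 {R kappa res pi d V L} Lbar r.

Section AffineWeyl.
Variable d : nat.
Local Notation Zd := 'rV[int]_d.

Definition affine_transformation (s : 'S_d) (v : Zd) : Zd -> Zd :=
  fun a => \row_k a 0 ((s^-1)%g k) + v.

Definition extended_affine_weyl : set (Zd -> Zd) :=
  [set w | exists s v, w = affine_transformation s v].

Definition affine_weyl : set (Zd -> Zd) :=
  [set w | exists s v, w = affine_transformation s v /\ \sum_k v 0 k = 0].

Definition left_coset (h : Zd -> Zd) (W : set (Zd -> Zd)) : set (Zd -> Zd) :=
  [set h \o w | w in W].

Definition double_coset (W : set (Zd -> Zd)) (h : Zd -> Zd) : set (Zd -> Zd) :=
  [set w1 \o h \o w2 | w1 in W & w2 in W].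

End AffineWeyl.

Section Bruhat.
Variables (R : idomainType) (kappa : fieldType) (res : {rmorphism R -> kappa}).
Variables (pi : R) (d : nat) (e : 'M[{fraction R}]_d).
Variables (V : finType) (a : V -> 'rV[int]_d).
Local Notation L := (fun v => apartment_lattice pi e (a v)).
Variable (Lbar : forall v, lattice_quotient res pi (L v)).
Variable (r : nat).

Local Notation J := (maximal_simplex pi L).
Local Notation Zd := 'rV[int]_d.
Local Notation Laurent := {fraction (powerSeries kappa)}.
Local Notation t := (ps_var kappa).

(* The subgroup W_tau of W_a; W_{j,j'} is obtained for tau = tau_j :&: tau_j'. *)
Definition weyl_fixer (tau : {set V}) : set (Zd -> Zd) :=
  [set w | affine_weyl w /\ forall v, v \in tau -> w (a v) = a v].

Definition admissible_collection : set (J -> set (Zd -> Zd)) :=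
  [set x | exists h : J -> Zd -> Zd,
    [/\ forall j : J, extended_affine_weyl (h j) /\
          x j = left_coset (h j) (weyl_fixer (val j)),
        forall (j : J) v, v \in val j ->
          (forall k, a v 0 k <= h j (a v) 0 k <= a v 0 k + 1) /\
          \sum_k h j (a v) 0 k - \sum_k a v 0 k = r%:Z &
        forall j j' : J, let W := weyl_fixer (val j :&: val j') in
          double_coset W (h j) = double_coset W (h j')]].

Definition Lambda (b : Zd) : set 'rV[Laurent]_d := apartment_lattice t 1%:M b.

(* The preimage of E_v in Lambda (a_v), the class of t ^ (- a_v k) e_k being
   identified with that of pi ^ (- a_v k) e_k. *)
Definition Lambda_preimage (v : V) (Ev : {vspace Lbar v}) :
    set 'rV[Laurent]_d :=
  [set \sum_k (c k)%:F *: scaled_basis t 1%:M (a v) k | c in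
    [set c : 'I_d -> powerSeries kappa |
      \sum_k c k 0%N *: quot_map (Lbar v) (scaled_basis pi e (a v) k) \in Ev]].

Definition translate (g : 'M[Laurent]_d) (M : set 'rV[Laurent]_d) :
    set 'rV[Laurent]_d := [set x *m g | x in M].

Definition parahoric (tau : {set V}) : set 'M[Laurent]_d :=
  [set g | \det g = 1 /\
    forall v, v \in tau -> translate g (Lambda (a v)) = Lambda (a v)].

Definition bruhat_stratum (x : J -> set (Zd -> Zd)) :
    set (forall v, {vspace Lbar v}) :=
  [set E | linked_grassmannian0 Lbar r E /\
    forall j : J, exists h g, [/\ x j h, parahoric (val j) g &
      forall v, v \in val j ->
        dilate t%:F^-1 (Lambda_preimage (E v)) = translate g (Lambda (h (a v)))]].

End Bruhat.

Arguments admissible_collection {R} pi {d} e {V} a r x.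
Arguments bruhat_stratum {R kappa res pi d e V a} Lbar r x.

(* Main.v *)
From HB Require Import structures.
Require Import Defs.
From mathcomp Require Import all_boot all_order all_fingroup all_algebra.
From mathcomp Require Import boolp zify ring.

(* On a simplex of [Gamma], with chain [L_0 < ... < L_m < pi^-1 L_0], the
   transition maps are coordinate projections whose kernels form, in each
   [L_v / pi L_v], a flag of coordinate subspaces. Refine these flags to complete
   ones, compatibly with the transition maps: the positions at which [E_v] jumps
   (its pivots) are then transported along the chain, and transporting a pivot
   vector from the first vertex where it occurs gives one matrix in the parahoric
   subgroup which carries a coordinate subrepresentation to [E]. The number of
   pivots in a block of coordinates killed at the same step is determined by the
   ranks, and pivots may be permuted inside a block, so the ranks on a simplex
   determine the parahoric orbit; conversely a parahoric element induces
   automorphisms of the [L_v / pi L_v] commuting with the transition maps.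
   By convexity the map [f_uv] has the same kernel as [f_uw] for some [w] equal or
   adjacent to [u], so the ranks on the simplices determine the rank vector.
   That the double cosets found on two simplices agree on their intersection is
   read off a term of the determinant expansion of a matrix of determinant 1 which
   is not divisible by [t]. *)

Set Implicit Arguments.
Unset Strict Implicit.
Unset Printing Implicit Defensive.

Import Order.TTheory GRing.Theory Num.Theory.
Local Open Scope ring_scope.

(** * Chains of subsets and pivots *)

(** The parahoric subgroup lives over kappa((t)), while ranks are linear algebra over kappa. They
    are linked by one scalar matrix A whose entry (k, l) is given the exponent of t equal to the
    maximum over u in tau of a_u(k) - a_u(l): this is the least exponent for which every Lambda(a_u)
    is preserved, and the reduction at v keeps exactly the entries for which v attains the maximum.
    The element h_j comes from the pivots: adding the indicator of the pivot set to each a_v gives a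
    chain of the same type, since pivots follow surviving coordinates, and two such chains whose
    coordinate sums differ by a constant are related by one extended affine permutation. Both this
    and the relabelling of pivots rest on the same fact about nested families of subsets with equal
    cardinalities. The quiver Grassmannian imposes conditions only along the arrows of Q(Gamma). The
    other conditions are recovered by induction on a length that drops strictly along any path on
    which a fixed coordinate survives. *)

Section ChainsOfSubsets.
Variable d : nat.

Lemma perm_of_fibers (T : eqType) (f g : 'I_d -> T) :
    (forall t, #|[set k | f k == t]| = #|[set k | g k == t]|) ->
  exists s : 'S_d, forall k, g (s k) = f k.
Proof.
move=> fg.
have cE (h : 'I_d -> T) t : count_mem t (mktuple h) = #|[set k | h k == t]|.
  rewrite /= count_map -size_filter cardE enumT; congr size.
  by apply: eq_filter => k /=; rewrite inE.
have /tuple_permP[s sE] : perm_eq (mktuple f) (mktuple g).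
  by apply/allP => t _ /=; rewrite !cE fg.
exists s => k; have := congr1 (fun u => nth (f k) u k) sE.
by rewrite !nth_mktuple tnth_mktuple.
Qed.

Definition chain (I : Type) (X : I -> {set 'I_d}) :=
  forall i j, (X i \subset X j) || (X j \subset X i).

(** In a chain a coordinate is located by its [key], the number of members containing it: it lies in
    Z i exactly when its key reaches the number of members at least as large as Z i. This threshold,
    and then the distribution of the keys, depend only on the cardinalities, so the two key
    functions have equally large fibers. *)
Lemma chain_perm (I : finType) (X Y : I -> {set 'I_d}) :
    chain X -> chain Y -> (forall i, #|X i| = #|Y i|) ->
  exists s : 'S_d, forall i k, (s k \in Y i) = (k \in X i).
Proof.
pose key (Z : I -> {set 'I_d}) k := #|[set i | k \in Z i]|.
have keyE Z i k : chain Z ->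
    (k \in Z i) = (#|[set j | (#|Z i| <= #|Z j|)%N]| <= key Z k)%N.
  move=> cZ; have [kZ|kZ] := boolP (k \in Z i).
    apply/esym/subset_leq_card/subsetP => j; rewrite !inE => ij.
    have /orP[/subsetP->//|ji] := cZ i j.
    by have /eqP -> : Z j == Z i by rewrite eqEcard ji.
  apply/esym/negbTE; rewrite -ltnNge; apply: proper_card.
  apply/properP; split; last by exists i; rewrite inE ?leqnn.
  apply/subsetP => j; rewrite !inE => kj.
  have /orP[/subset_leq_card//|/subsetP/(_ _ kj)] := cZ i j.
  by rewrite (negbTE kZ).
move=> cX cY XY.
have keyXY m : #|[set k | (m <= key X k)%N]| = #|[set k | (m <= key Y k)%N]|.
  (* For m > 0 the coordinates of key at least m form the largest member whose threshold is at least
     m, or the empty set if there is none. *)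
  have main Z : chain Z ->
      #|[set k | (m <= key Z k)%N]| =
      if m == 0%N then d
      else \max_(i | (m <= #|[set j | (#|Z i| <= #|Z j|)%N]|)%N) #|Z i|.
    move=> cZ; case: eqP => [->|/eqP m0].
      by rewrite (_ : [set k | _] = [set: 'I_d]) ?cardsT ?card_ord //;
        apply/setP => k; rewrite !inE.
    apply/eqP; rewrite eqn_leq; apply/andP; split; last first.
      apply/bigmax_leqP => i mi; apply/subset_leq_card/subsetP => k.
      by rewrite (keyE _ _ _ cZ) inE; apply: leq_trans.
    have [->|[k0]] := set_0Vmem [set k | (m <= key Z k)%N]; first by rewrite cards0.
    rewrite inE => mk0.
    case: (@arg_minnP _ k0 (fun k => m <= key Z k)%N (key Z)) => //= k mk kmin.
    have : (0 < key Z k)%N by apply: leq_trans mk; rewrite lt0n.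
    rewrite card_gt0 => /set0Pn[i0]; rewrite inE => ki0.
    case: (@arg_minnP _ i0 (fun i => k \in Z i) (fun i => #|Z i|)) => //= i ki imin.
    have iE : #|[set j | (#|Z i| <= #|Z j|)%N]| = key Z k.
      apply/eqP; rewrite eqn_leq -keyE // ki /=.
      by apply/subset_leq_card/subsetP => j; rewrite !inE; apply: imin.
    apply: (@leq_trans #|Z i|).
      apply/subset_leq_card/subsetP => l; rewrite inE => ml.
      by rewrite keyE // iE kmin.
    by apply: (@leq_bigmax_cond _ _ (fun i => #|Z i|)); rewrite iE.
  rewrite !main //; case: eqP => // _; apply: eq_big => i; last by rewrite XY.
  by congr (_ <= _)%N; apply: eq_card => j; rewrite !inE !XY.
have [s sE] : exists s : 'S_d, forall k, key Y (s k) = key X k.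
  apply: perm_of_fibers => m.
  have main Z : #|[set k | key Z k == m]| =
      (#|[set k | (m <= key Z k)%N]| - #|[set k | (m.+1 <= key Z k)%N]|)%N.
    rewrite -cardsDS; last by apply/subsetP => k; rewrite !inE => /ltnW.
    by apply: eq_card => k; rewrite !inE -leqNgt eqn_leq.
  by rewrite !main !keyXY.
exists s => i k; rewrite !keyE // sE; congr (_ <= _)%N.
by apply: eq_card => j; rewrite !inE !XY.
Qed.

End ChainsOfSubsets.

(** * Pivots of a subspace for an ordering of the coordinates *)

Section Pivots.
Variables (F : fieldType) (d : nat).
Implicit Types (E : {vspace 'rV[F]_d}) (D : {set 'I_d}) (x y : 'rV[F]_d).

Definition coord_restrict D x : 'rV[F]_d :=
  \row_k (if k \in D then x 0 k else 0).

Fact coord_restrict_linear D : linear (coord_restrict D).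
Proof.
move=> c x y; apply/rowP => k; rewrite !mxE.
by case: ifP => // _; rewrite mulr0 addr0.
Qed.

HB.instance Definition _ D :=
  GRing.isLinear.Build _ _ _ _ (coord_restrict D) (coord_restrict_linear D).

Definition coord_proj D : 'End('rV[F]_d) := linfun (coord_restrict D).

Lemma coord_projE D x k : coord_proj D x 0 k = if k \in D then x 0 k else 0.
Proof. by rewrite lfunE mxE. Qed.

Lemma mem_lker_coord_proj D x :
  (x \in lker (coord_proj D)) = [forall k in D, x 0 k == 0].
Proof.
rewrite memv_ker; apply/eqP/forall_inP => [x0 k kD|x0].
  by have /rowP/(_ k) := x0; rewrite coord_projE kD mxE => ->.
by apply/rowP => k; rewrite coord_projE mxE; case: ifP => // /x0/eqP.
Qed.

Variable key : 'I_d -> int.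
Hypothesis key_inj : injective key.

(** These are the positions of the leading ones in an echelon form of E, the leading coordinate
    being the nonzero one of largest key. *)
Definition pivot E k :=
  `[< exists x, [/\ x \in E, x 0 k = 1 & forall l, key k < key l -> x 0 l = 0] >].

(** The kernel on the right consists of the vectors supported on D. Removing from D its coordinate k
    of largest key shrinks the intersection with E by the line of a pivot vector if k is a pivot,
    and not at all otherwise. *)
Lemma card_pivots E D :
    (forall k l, k \in D -> key l <= key k -> l \in D) ->
  #|[set k in D | pivot E k]| = \dim (E :&: lker (coord_proj (~: D))).
Proof.
have [n] := ubnP #|D|; elim: n => // n IHn in D * => /ltnSE Dn Ddown.
have [->|[k0 k0D]] := set_0Vmem D.
  rewrite (_ : [set k in _ | _] = set0); last by apply/setP => k; rewrite !inE.
  rewrite cards0; apply/esym/eqP; rewrite dimv_eq0 -subv0; apply/subvP => x.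
  rewrite memv_cap mem_lker_coord_proj memv0 => /andP[_ /forall_inP x0].
  by apply/eqP/rowP => k; rewrite mxE; apply/eqP/x0; rewrite !inE.
have [k kD kmax] : exists2 k, k \in D & forall l, l \in D -> key l <= key k.
  by have [k ? ?] := @arg_maxP _ _ _ k0 (mem D) key k0D; exists k.
have D'down k' l : k' \in D :\ k -> key l <= key k' -> l \in D :\ k.
  rewrite !inE => /andP[k'k k'D] lk'; rewrite (Ddown _ _ k'D lk') andbT.
  apply: contraNneq k'k => lk; rewrite lk in lk'.
  by apply/eqP/key_inj/eqP; rewrite eq_le lk' kmax.
have D'n : (#|D :\ k| < n)%N by rewrite (cardsD1 k D) kD in Dn.
have memC x : (x \in lker (coord_proj (~: (D :\ k)))) =
    (x \in lker (coord_proj (~: D))) && (x 0 k == 0).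
  rewrite !mem_lker_coord_proj; apply/forall_inP/andP => [h|[/forall_inP h xk] l].
    split; last by apply: h; rewrite !inE eqxx.
    by apply/forall_inP => l lD; apply: h; move: lD; rewrite !inE negb_and orbC => ->.
  by rewrite !inE negb_and negbK => /orP[/eqP->//|lD]; apply: h; rewrite inE.
have := IHn _ D'n D'down; set U' := (E :&: _)%VS => IH.
have [pk|npk] := boolP (pivot E k); last first.
  rewrite (_ : [set k in _ | _] = [set l in D :\ k | pivot E l]); last first.
    apply/setP => l; rewrite !inE; case: (eqVneq l k) => //= ->.
    by rewrite (negbTE npk) andbF.
  rewrite IH; congr (\dim _); apply/eqP; rewrite eqEsubv; apply/andP; split.
    by apply/subvP => x; rewrite !memv_cap memC => /and3P[-> ->].
  apply/subvP => x; rewrite !memv_cap memC => /andP[xE xD]; rewrite xE xD /=.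
  apply: contraNT npk => xk; apply/asboolP; exists ((x 0 k)^-1 *: x).
  rewrite memvZ // mxE mulVf //; split=> // l kl; rewrite mxE.
  move: xD; rewrite mem_lker_coord_proj => /forall_inP xD.
  rewrite (eqP (xD l _)) ?mulr0 // inE.
  by apply/negP => /kmax; rewrite leNgt kl.
rewrite (cardsD1 k) !inE kD pk add1n.
rewrite (_ : _ :\ k = [set l in D :\ k | pivot E l]); last first.
  by apply/setP => l; rewrite !inE andbA.
rewrite IH; have /asboolP[x [xE xk xl]] := pk.
have xD : x \in lker (coord_proj (~: D)).
  rewrite mem_lker_coord_proj; apply/forall_inP => l; rewrite inE => lD.
  apply/eqP/xl; rewrite ltNge; apply: contra lD; exact: Ddown.
have x0 : x != 0 by apply: contraTneq (oner_neq0 F) => x0; rewrite -xk x0 mxE eqxx.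
have -> : (E :&: lker (coord_proj (~: D)) = U' + <[x]>)%VS.
  apply/eqP; rewrite eqEsubv; apply/andP; split; last first.
    rewrite subv_add; apply/andP; split; last by rewrite -memvE memv_cap xE xD.
    by apply/subvP => y; rewrite !memv_cap memC => /and3P[-> ->].
  apply/subvP => y; rewrite memv_cap => /andP[yE yD].
  rewrite -[y](subrK (y 0 k *: x)); apply: memv_add; last by rewrite memvZ ?memv_line.
  by rewrite memv_cap memC !memvB ?memvZ //= !mxE xk mulr1 subrr.
rewrite dimv_disjoint_sum ?dim_vline ?x0 ?addn1 //.
apply/eqP; rewrite -subv0; apply/subvP => y.
rewrite !memv_cap memC => /andP[/and3P[_ _ yk] /vlineP[c yE]].
by move: yk; rewrite yE mxE xk mulr1 memv0 => /eqP ->; rewrite scale0r.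
Qed.

End Pivots.

(** * Chains of coordinate lattices *)

Section NearChains.
Variables (d : nat) (V : finType).
Implicit Types (a b : V -> 'rV[int]_d) (tau : {set V}).

(* The translates of the [a v], [v \in tau], by multiples of [(1, ..., 1)] are
   totally ordered coordinatewise. *)
Definition near_chain a tau := forall u v, u \in tau -> v \in tau ->
  (forall k, 0 <= a v 0 k - a u 0 k <= 1) \/
  (forall k, -1 <= a v 0 k - a u 0 k <= 0).

(** Along a near chain a v k - a v l takes at most two values, and these are consecutive, so its
    comparison with z never shows both strict signs. *)
Lemma near_chain_cmp a tau k l (z : int) : near_chain a tau ->
  (forall v, v \in tau -> a v 0 k <= a v 0 l + z) \/
  (forall v, v \in tau -> a v 0 l + z <= a v 0 k).
Proof.
move=> chn.
have [/forall_inP h|/forall_inPn[u utau]] :=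
  boolP [forall v in tau, a v 0 k <= a v 0 l + z]; first by left.
rewrite -ltNge => ukl; right=> v vtau.
by case: (chn u v utau vtau) => h; have := h k; have := h l; lia.
Qed.

Lemma card_sum_int (A : {set 'I_d}) : #|A|%:Z = \sum_k (k \in A)%:Z.
Proof.
rewrite -sum1_card (big_morph Posz (id1 := 0) (op1 := +%R)) //.
by rewrite big_mkcond; apply: eq_bigr => k _; case: ifP.
Qed.

(** Relative to a base vertex v0, both chains take at v only the values m and m - 1 with a common m.
    The coordinates where m is taken form nested families, of equal cardinalities because the sums
    agree. *)
Lemma near_chain_affine a b tau (r : int) :
    near_chain a tau -> near_chain b tau ->
    (forall v, v \in tau -> \sum_k b v 0 k - \sum_k a v 0 k = r) ->
  exists s z, forall v, v \in tau -> b v = affine_transformation s z (a v).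
Proof.
move=> chna chnb ab.
have [->|[v0 v0tau]] := set_0Vmem tau.
  by exists 1%g, 0 => v; rewrite inE.
(* The bound is 1 if both chains go up from v0 to v, and 0 if both go down. If one goes up and the
   other down, equal sums force both displacements to vanish, and 0 serves again. *)
have /choice[dl dlP] v : exists m : int, v \in tau -> forall k,
    (m - 1 <= a v 0 k - a v0 0 k <= m) /\ (m - 1 <= b v 0 k - b v0 0 k <= m).
  have [vtau|_] := boolP (v \in tau); last by exists 0.
  have sE : \sum_k (a v 0 k - a v0 0 k) = \sum_k (b v 0 k - b v0 0 k).
    rewrite !sumrB; move: (ab v vtau) (ab v0 v0tau).
    move: (\sum_k a v 0 k) (\sum_k b v 0 k) => x y.
    move: (\sum_k a v0 0 k) (\sum_k b v0 0 k) => x' y'. lia.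
  have zero (f g : 'I_d -> int) : (forall k, 0 <= f k) -> (forall k, g k <= 0) ->
      \sum_k f k = \sum_k g k -> (forall k, f k = 0) /\ (forall k, g k = 0).
    move=> f0 g0 fg.
    have s0 : \sum_k f k = 0.
      by apply/eqP; rewrite eq_le {1}fg sumr_le0 ?sumr_ge0.
    split=> k; first by apply: (psumr_eq0P _ s0).
    have s1 : \sum_k - g k = 0 by rewrite sumrN -fg s0 oppr0.
    apply/oppr_inj; rewrite oppr0; apply: (psumr_eq0P _ s1) => // i _.
    by rewrite oppr_ge0.
  case: (chna v0 v v0tau vtau) => ha; case: (chnb v0 v v0tau vtau) => hb.
  - by exists 1 => _ k; have := ha k; have := hb k; lia.
  - exists 0 => _ k; have [||ha0 hb0] := zero _ _ _ _ sE.
    + by move=> l; have := ha l; lia.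
    + by move=> l; have := hb l; lia.
    by have := ha0 k; have := hb0 k; lia.
  - exists 0 => _ k; have [||hb0 ha0] := zero _ _ _ _ (esym sE).
    + by move=> l; have := hb l; lia.
    + by move=> l; have := ha l; lia.
    by have := ha0 k; have := hb0 k; lia.
  - by exists 0 => _ k; have := ha k; have := hb k; lia.
(* The test [v \in tau] makes the members outside tau empty, so that the family indexed by all of V
   is still a chain. *)
pose X (c : V -> 'rV[int]_d) v :=
  [set k | (v \in tau) && (c v 0 k - c v0 0 k == dl v)].
have chX c : near_chain c tau ->
    (forall v k, v \in tau -> c v 0 k - c v0 0 k <= dl v) -> chain (X c).
  move=> chnc dlc v w; apply/orP.
  have [|/subsetPn[k]] := boolP (X c v \subset X c w); first by left.
  rewrite !inE => /andP[vtau /eqP kv] kw.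
  have [|/subsetPn[l]] := boolP (X c w \subset X c v); first by right.
  rewrite !inE => /andP[wtau /eqP lw] lv; exfalso.
  have {kw} kw : c w 0 k - c v0 0 k != dl w by move: kw; rewrite wtau.
  have {lv} lv : c v 0 l - c v0 0 l != dl v by move: lv; rewrite vtau.
  have := dlc w k wtau; have := dlc v l vtau.
  case: (near_chain_cmp k l (c v0 0 k - c v0 0 l) chnc) => h;
    have := h v vtau; have := h w wtau; lia.
have [s sP] : exists s : 'S_d, forall v k, (s k \in X b v) = (k \in X a v).
  apply: chain_perm.
  - by apply: chX => // v k vtau; have := dlP v vtau k; lia.
  - by apply: chX => // v k vtau; have := dlP v vtau k; lia.
  move=> v; have [vtau|nv] := boolP (v \in tau); last first.
    by apply: eq_card => k; rewrite !inE (negbTE nv).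
  have cX (c : V -> 'rV[int]_d) : (forall k, dl v - 1 <= c v 0 k - c v0 0 k <= dl v) ->
      #|X c v|%:Z = \sum_k (c v 0 k - c v0 0 k - dl v + 1).
    move=> dlc; rewrite card_sum_int; apply: eq_bigr => k _.
    rewrite inE vtau /=; have := dlc k.
    by have [->|] := eqVneq (c v 0 k - c v0 0 k) (dl v); lia.
  apply/eqP; rewrite -eqz_nat; apply/eqP.
  rewrite !cX; try by move=> k; have [] := dlP v vtau k.
  rewrite !big_split /= !sumrN.
  congr (_ + _ + _); move: (ab v vtau) (ab v0 v0tau).
  move: (\sum_k a v 0 k) (\sum_k b v 0 k) => x y.
  by move: (\sum_k a v0 0 k) (\sum_k b v0 0 k) => x' y'; lia.
exists s, (\row_k (b v0 0 k - a v0 0 ((s^-1)%g k))) => v vtau.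
apply/rowP => k; rewrite !mxE; set l := (s^-1)%g k.
have -> : k = s l by rewrite permKV.
have := sP v l; rewrite !inE vtau /=.
have := dlP v vtau l; have := dlP v vtau (s l).
by do 2 case: eqVneq; lia.
Qed.

Variables (a : V -> 'rV[int]_d).

(* The coordinates on which [transition u v] is the identity; it vanishes on
   the other ones. *)
Definition surviving (u v : V) : {set 'I_d} :=
  [set k | [forall l, a u 0 l - a v 0 l <= a u 0 k - a v 0 k]].

Lemma survivingP u v k :
  reflect (forall l, a u 0 l - a v 0 l <= a u 0 k - a v 0 k)
          (k \in surviving u v).
Proof. by rewrite inE; apply: forallP. Qed.

Lemma surviving_refl u : surviving u u = [set: 'I_d].
Proof. by apply/setP => k; rewrite in_setT; apply/survivingP => l; lia. Qed.

Lemma surviving_eq u v k l : k \in surviving u v ->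
  (l \in surviving u v) = (a u 0 l - a v 0 l == a u 0 k - a v 0 k).
Proof.
move=> /survivingP kuv; apply/survivingP/eqP => [luv|-> //].
by have := kuv l; have := luv k; lia.
Qed.

Variable tau : {set V}.
Hypothesis chn : near_chain a tau.

(** The difference a u - a v takes at most two consecutive values: coordinates survive towards v at
    the larger one and towards u at the smaller one. *)
Lemma surviving_total u v k : u \in tau -> v \in tau ->
  (k \in surviving u v) || (k \in surviving v u).
Proof.
move=> utau vtau; apply/orP.
have [|nk] := boolP (k \in surviving u v); first by left.
right; apply/survivingP => l.
move: nk; rewrite inE => /forallPn[m]; rewrite -ltNge.
by case: (chn utau vtau) => h; have := h k; have := h l; have := h m; lia.
Qed.

Lemma surviving_chain u v w : u \in tau -> v \in tau -> w \in tau ->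
  (surviving u v \subset surviving u w) || (surviving u w \subset surviving u v).
Proof.
move=> utau vtau wtau; apply/orP.
have [|/subsetPn[k kv kw]] := boolP (surviving u v \subset surviving u w).
  by left.
have [|/subsetPn[l lw lv]] := boolP (surviving u w \subset surviving u v).
  by right.
exfalso; move: lv kw; rewrite (surviving_eq _ kv) (surviving_eq _ lw).
have /survivingP/(_ l) := kv; have /survivingP/(_ k) := lw.
case: (near_chain_cmp k l (a u 0 k - a u 0 l) chn) => h;
  have := h v vtau; have := h w wtau; lia.
Qed.

Definition block k l :=
  [forall u in tau, forall v in tau,
     a v 0 k - a v 0 l == a u 0 k - a u 0 l].

Lemma blockP k l :
  reflect {in tau &, forall u v, a v 0 k - a v 0 l = a u 0 k - a u 0 l}
          (block k l).
Proof.
apply: (iffP forall_inP) => [h u v utau vtau|h u utau].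
  by apply/eqP; apply: (forall_inP (h u utau)).
by apply/forall_inP => v vtau; apply/eqP; apply: h.
Qed.

Lemma block_refl k : block k k.
Proof. by apply/blockP => u v _ _; lia. Qed.

Lemma block_sym k l : block k l = block l k.
Proof.
by apply/blockP/blockP => h u v utau vtau; have := h u v utau vtau; lia.
Qed.

Lemma block_trans k l m : block k l -> block l m -> block k m.
Proof.
move=> /blockP kl /blockP lm; apply/blockP => u v utau vtau.
by have := kl u v utau vtau; have := lm u v utau vtau; lia.
Qed.

Lemma block_surviving u v k l : u \in tau -> v \in tau -> block k l ->
  (k \in surviving u v) = (l \in surviving u v).
Proof.
move=> utau vtau /blockP/(_ u v utau vtau) kl.
by apply/survivingP/survivingP => h m; have := h m; lia.
Qed.

(** Survival out of a single vertex fixes the block: if k and l survive from u to v they are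
    displaced equally; if neither does, both survive from v to u and the same holds. *)
Lemma surviving_block u k l : u \in tau ->
    (forall v, v \in tau -> (k \in surviving u v) = (l \in surviving u v)) ->
  block k l.
Proof.
move=> utau kl.
suff h v : v \in tau -> a v 0 k - a v 0 l = a u 0 k - a u 0 l.
  by apply/blockP => v w vtau wtau; rewrite !h.
move=> vtau; have [ku|ku] := boolP (k \in surviving u v).
  have := ku; rewrite kl // (surviving_eq _ ku) => /eqP; lia.
have := surviving_total k utau vtau; rewrite (negbTE ku) /= => kv.
have := surviving_total l utau vtau; rewrite -kl // (negbTE ku) /=.
rewrite (surviving_eq _ kv) => /eqP; lia.
Qed.

(* The main term orders the coordinates by the step of the chain, starting
   from [u], at which they are killed; [k] breaks the ties. *)
Definition pivot_key u (k : 'I_d) : int :=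
  d%:Z * (#|tau|%:Z * a u 0 k - \sum_(v in tau) a v 0 k) + k%:Z.

(** The remainders k and l are below d, which is why [pivot_key] multiplies its main term by d. *)
Lemma lex_le (A B : int) (k l : 'I_d) :
  d%:Z * A + k%:Z <= d%:Z * B + l%:Z -> A <= B.
Proof.
rewrite leNgt => AB; rewrite leNgt; apply: contra AB => BA.
have : d%:Z * (B + 1) <= d%:Z * A by rewrite ler_wpM2l // lezD1.
have := ltn_ord l; rewrite mulrDr mulr1.
move: (_ * A) (_ * B) => x y; lia.
Qed.

Lemma pivot_key_inj u : injective (pivot_key u).
Proof.
move=> k l; rewrite /pivot_key; set A := _ - _; set B := _ - _ => kl.
have AB : A = B.
  apply/eqP; rewrite eq_le; apply/andP.
  by split; [apply: (@lex_le A B k l)|apply: (@lex_le B A l k)]; rewrite kl.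
by apply: val_inj; move: kl; rewrite AB => /addrI /(congr1 absz).
Qed.

(** The key only compares sums over tau, but by [near_chain_cmp] the comparison of k and l has one
    weak direction at all vertices, so a strict inequality at v alone would decide the comparison of
    the sums. *)
Lemma pivot_key_le u v k l : u \in tau -> v \in tau ->
  pivot_key u l <= pivot_key u k -> a v 0 k - a u 0 k <= a v 0 l - a u 0 l.
Proof.
move=> utau vtau lk.
have {lk} : \sum_(w in tau) (a w 0 k - a u 0 k) <=
    \sum_(w in tau) (a w 0 l - a u 0 l).
  have sE m : \sum_(w in tau) (a w 0 m - a u 0 m) =
      \sum_(w in tau) a w 0 m - #|tau|%:Z * a u 0 m.
    by rewrite sumrB sumr_const -mulr_natl natz.
  rewrite !sE.
  move: lk; rewrite /pivot_key => /lex_le; move: (\sum_(w in tau) a w 0 k) (\sum_(w in tau) a w 0 l).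
  by move: (_ * a u 0 k) (_ * a u 0 l) => x y Sk Sl; lia.
case: (near_chain_cmp k l (a u 0 k - a u 0 l) chn) => h S.
  by have := h v vtau; lia.
rewrite leNgt; apply/negP => lt; move: S; rewrite leNgt => /negP[].
rewrite (bigD1 v vtau) /= [X in _ < X](bigD1 v vtau) /=.
apply: ltr_leD => //; apply: ler_sum => w /andP[wtau _].
by have := h w wtau; lia.
Qed.

(** When k and l are displaced equally from u to v the correction vanishes, and both vertices order
    them alike: the refined flags are compatible with the transition maps. *)
Lemma pivot_keyB u v k l :
  pivot_key v k - pivot_key v l =
  pivot_key u k - pivot_key u l +
  d%:Z * #|tau|%:Z * ((a v 0 k - a v 0 l) - (a u 0 k - a u 0 l)).
Proof.
rewrite /pivot_key.
move: (\sum_(w in tau) a w 0 k) (\sum_(w in tau) a w 0 l) => Sk Sl.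
by ring.
Qed.

End NearChains.

(** * Transport of pivots along a simplex *)

Section Frames.
Variables (F : fieldType) (d : nat) (V : finType).
Variables (a : V -> 'rV[int]_d) (tau : {set V}).
Hypothesis chn : near_chain a tau.
Implicit Types (E : V -> {vspace 'rV[F]_d}) (J : V -> {set 'I_d}).

Definition linked_on E := {in tau &, forall u v,
  (coord_proj F (surviving a u v) @: E u <= E v)%VS}.

Definition pivots E u : {set 'I_d} := [set k | pivot (pivot_key a tau u) (E u) k].

(** The coordinates killed from u to v form an initial segment for the key at u, so the pivots among
    them count the dimension of the kernel of the projection on E u. *)
Lemma card_pivots_killed E u v : u \in tau -> v \in tau ->
  (#|pivots E u :\: surviving a u v| +
     \dim (coord_proj F (surviving a u v) @: E u))%N = \dim (E u).
Proof.
move=> utau vtau.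
have := @card_pivots F d _ (pivot_key_inj (a := a) (tau := tau) (u := u)) (E u)
  (~: surviving a u v).
rewrite setCK (_ : [set k in _ | _] = pivots E u :\: surviving a u v); last first.
  by apply/setP => k; rewrite !inE.
move=> h; rewrite {}h; first exact: limg_ker_dim.
move=> k l; rewrite inE => ku lk; rewrite inE; apply: contra ku.
move=> /survivingP lu; apply/survivingP => m.
by have := pivot_key_le chn utau vtau lk; have := lu m; lia.
Qed.

Lemma card_pivotsE E u : #|pivots E u| = \dim (E u).
Proof.
have := @card_pivots F d _ (pivot_key_inj (a := a) (tau := tau) (u := u)) (E u)
  [set: 'I_d].
rewrite (_ : [set k in _ | _] = pivots E u); last by apply/setP => k; rewrite !inE.
move=> h; rewrite {}h => [|k l _ _]; last by rewrite inE.
congr (\dim _); apply/capv_idPl/subvP => x _.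
by rewrite mem_lker_coord_proj; apply/forall_inP => k; rewrite !inE.
Qed.

Lemma pivots_surviving E u v k : linked_on E -> u \in tau -> v \in tau ->
  k \in pivots E u -> k \in surviving a u v -> k \in pivots E v.
Proof.
move=> lnk utau vtau; rewrite inE => /asboolP[x [xE xk xl]] ku.
rewrite inE; apply/asboolP; exists (coord_proj F (surviving a u v) x); split.
- by apply: subvP (lnk u v utau vtau) _ _; rewrite memv_img.
- by rewrite coord_projE ku.
move=> l kl; rewrite coord_projE; case: ifP => // lu; apply: xl.
have := pivot_keyB a tau u v k l.
move: lu; rewrite (surviving_eq _ ku) => /eqP lu.
rewrite (_ : a v 0 k - a v 0 l - _ = 0); last by lia.
rewrite mulr0; lia.
Qed.

(** The reduction modulo t, in the basis of Lambda (a v), of the matrix whose entry is A k l times t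
    to the maximum over u in tau of a u k - a u l. *)
Definition frame_matrix (A : 'M[F]_d) v : 'M[F]_d :=
  \matrix_(k, l)
    if [forall u in tau, a u 0 k - a u 0 l <= a v 0 k - a v 0 l]
    then A k l else 0.

(* [frame E J] says that the spaces [E v] are the images of the coordinate
   subspaces [J v] under one automorphism of the restriction of the
   representation to [tau]; [A] is the leading term of such an automorphism. *)
Definition frame E J := exists A, forall v, v \in tau ->
  [/\ frame_matrix A v \in unitmx, #|J v| = \dim (E v) &
      forall k, k \in J v -> row k (frame_matrix A v) \in E v].

(** G is triangular for the order of the keys: in a nonzero row killed by G, the nonzero coordinate
    of largest key would be left unchanged. *)
Lemma unitmx_unipotent (key : 'I_d -> int) (G : 'M[F]_d) :
    injective key -> (forall k, G k k = 1) ->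
    (forall k l, G k l != 0 -> key l <= key k) ->
  G \in unitmx.
Proof.
move=> key_inj G1 Gle; rewrite -row_free_unit -kermx_eq0; apply/eqP/row_matrixP => i.
rewrite row0; set y := row i _.
have yG : y *m G = 0 by rewrite -row_mul mulmx_ker row0.
move: y yG => {i} y yG; apply/eqP; apply: contraT => /eqP y0.
have [k0 yk0] : exists k, y 0 k != 0.
  apply: contrapT => h; apply: y0; apply/rowP => k; rewrite mxE; apply/eqP.
  by apply: contrapT => /negP yk; apply: h; exists k.
have [k yk kmax] := @arg_maxP _ _ _ k0 (fun k => y 0 k != 0) key yk0.
have /rowP/(_ k) := yG; rewrite !mxE (bigD1 k) //= G1 mulr1 big1 ?addr0.
  by move=> yk0'; rewrite yk0' eqxx in yk.
move=> l lk; apply/eqP; rewrite mulf_eq0; apply/norP => -[yl Gl].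
have := Gle _ _ Gl; have := kmax l yl => /= ll kk.
by case/eqP: lk; apply: key_inj; apply/le_anti; rewrite ll kk.
Qed.

(* The pivot vector of [k] is chosen at the first vertex [q] of the chain where
   [k] is a pivot, so that it is transported to all the other ones. *)
Lemma pivots_frame E : tau != set0 -> linked_on E -> frame E (pivots E).
Proof.
move=> /set0Pn[v0 v0tau] lnk.
have /choice[x xP] k : exists x : 'rV[F]_d, exists q, [/\ q \in tau, x 0 k = 1,
    forall l, pivot_key a tau q k < pivot_key a tau q l -> x 0 l = 0 &
    forall v, v \in tau -> k \in pivots E v ->
      (k \in surviving a q v) && (x \in E q)].
  have [/exists_inP[u utau ku]|/exists_inPn none] :=
      boolP [exists u in tau, k \in pivots E u]; last first.
    exists (delta_mx 0 k), v0; split=> //.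
    - by rewrite mxE !eqxx.
    - by move=> l kl; rewrite mxE eqxx /=; case: eqVneq kl => // ->; rewrite ltxx.
    by move=> v vtau kv; have := none v vtau; rewrite kv.
  (* If k were killed from q to a vertex v where it is also a pivot, it would survive from v to q
     and [psi] would be strictly larger at v. Maximizing [psi] thus selects the first vertex. *)
  pose psi w := \sum_l (a w 0 k - a w 0 l).
  have uP : (u \in tau) && (k \in pivots E u) by rewrite utau.
  have [q /andP[qtau kq] qmax] := @arg_maxP _ _ _ u
    (fun u => (u \in tau) && (k \in pivots E u)) psi uP.
  have := kq; rewrite inE => /asboolP[x [xE xk xl]].
  exists x, q; split=> // v vtau kv; rewrite xE andbT.
  apply: contraT => nkq; have := nkq; rewrite inE => /forallPn[m].
  rewrite -ltNge => mq.
  have := surviving_total chn k qtau vtau; rewrite (negbTE nkq) /= => /survivingP vq.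
  have := qmax v; rewrite /= vtau kv => /(_ isT); rewrite leNgt => /negP[].
  rewrite /psi (bigD1 m) //= [X in _ < X](bigD1 m) //=.
  apply: ltr_leD; first by lia.
  by apply: ler_sum => l _; have := vq l; lia.
pose A : 'M[F]_d := \matrix_k x k.
have AE k l : A k l = x k 0 l by rewrite !mxE.
(* A nonzero entry lies at a key not above that of the pivot, so q attains the maximum defining its
   exponent. Hence, when k survives from q to v, the entry is kept at v exactly when l survives
   too. *)
have Adom q k l : q \in tau -> A k l != 0 ->
    (forall l, pivot_key a tau q k < pivot_key a tau q l -> x k 0 l = 0) ->
  forall u, u \in tau -> a u 0 k - a u 0 l <= a q 0 k - a q 0 l.
  move=> qtau Akl xl u utau.
  have lk : pivot_key a tau q l <= pivot_key a tau q k.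
    by rewrite leNgt; apply: contra Akl => /xl; rewrite AE => ->.
  by have := pivot_key_le chn qtau utau lk; lia.
exists A => v vtau; split; last 2 first.
- exact: card_pivotsE.
- move=> k kv; have [q [qtau xk xl /(_ v vtau kv) /andP[kq xE]]] := xP k.
  rewrite (_ : row _ _ = coord_proj F (surviving a q v) (x k)); last first.
    apply/rowP => l; rewrite coord_projE !mxE.
    have [Akl|Akl] := eqVneq (x k 0 l) 0; first by rewrite Akl; do 2 case: ifP.
    rewrite (surviving_eq _ kq).
    have dom := Adom q k l qtau; rewrite AE in dom; have {dom} dom := dom Akl xl.
    congr (if _ then _ else _); apply/forall_inP/eqP => [dv|lq u utau].
      by have := dom v vtau; have := dv q qtau; lia.
    by have := dom u utau; lia.
  by apply: subvP (lnk q v qtau vtau) _ _; rewrite memv_img.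
apply: (@unitmx_unipotent (pivot_key a tau v)) => [|k|k l].
- exact: pivot_key_inj.
- rewrite mxE; case: ifP => [_|/negbT/forall_inPn[u utau]]; last by rewrite !subrr.
  by rewrite AE; have [q []] := xP k.
rewrite mxE; case: ifP => [/forall_inP dv Akl|]; last by rewrite eqxx.
have [q [qtau xk xl _]] := xP k.
have dq := Adom q k l qtau Akl xl.
have lk : pivot_key a tau q l <= pivot_key a tau q k.
  by rewrite leNgt; apply: contra Akl => /xl; rewrite AE => ->.
have := pivot_keyB a tau q v k l.
rewrite (_ : a v 0 k - a v 0 l - _ = 0); last by have := dv q qtau; have := dq v vtau; lia.
rewrite mulr0; lia.
Qed.

(** Lambda of this vector is t^-1 times the preimage in Lambda (a v) of the coordinate subspace
    spanned by J v. *)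
Definition shift_on J v : 'rV[int]_d := a v + \row_k (k \in J v)%:Z.

Lemma shift_onE J v k : shift_on J v 0 k = a v 0 k + (k \in J v)%:Z.
Proof. by rewrite !mxE. Qed.

(** Say a v lies above a u. Where a v k = a u k, a pivot k at u stays one at v; where a v k = a u k
    + 1, a pivot at v stays one at u. Either way the shifted difference remains 0 or 1. *)
Lemma pivots_near_chain E : linked_on E -> near_chain (shift_on (pivots E)) tau.
Proof.
move=> lnk u v utau vtau.
have J := fun u v k => @pivots_surviving E u v k lnk.
case: (chn utau vtau) => h; [left|right] => k; rewrite !shift_onE; have hk := h k.
- have [e|e] : a v 0 k = a u 0 k \/ a v 0 k = a u 0 k + 1 by lia.
    have ku : k \in surviving a u v by apply/survivingP => l; have := h l; lia.
    have := J u v k utau vtau; rewrite ku.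
    by case: (k \in pivots E u) => [/(_ isT isT) ->|_]; lia.
  have kv : k \in surviving a v u by apply/survivingP => l; have := h l; lia.
  have := J v u k vtau utau; rewrite kv.
  by case: (k \in pivots E v) => [/(_ isT isT) ->|_]; lia.
have [e|e] : a v 0 k = a u 0 k \/ a v 0 k = a u 0 k - 1 by lia.
  have kv : k \in surviving a v u by apply/survivingP => l; have := h l; lia.
  have := J v u k vtau utau; rewrite kv.
  by case: (k \in pivots E v) => [/(_ isT isT) ->|_]; lia.
have ku : k \in surviving a u v by apply/survivingP => l; have := h l; lia.
have := J u v k utau vtau; rewrite ku.
by case: (k \in pivots E u) => [/(_ isT isT) ->|_]; lia.
Qed.

Section EqualRanks.
Variables E E' : V -> {vspace 'rV[F]_d}.
Hypothesis lnk : linked_on E.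
Hypothesis lnk' : linked_on E'.
Hypothesis dimE : forall v, v \in tau -> \dim (E v) = \dim (E' v).
Hypothesis rankE : {in tau &, forall u v,
  \dim (coord_proj F (surviving a u v) @: E u) =
  \dim (coord_proj F (surviving a u v) @: E' u)}.

(** The sets surviving from u are nested, and the block of k0 is the gap between the largest one
    missing k0 and the smallest one containing it. The ranks give the number of pivots outside each
    of these sets. *)
Lemma card_pivots_block u k0 : u \in tau ->
  #|[set k in pivots E u | block a tau k k0]| =
  #|[set k in pivots E' u | block a tau k k0]|.
Proof.
move=> utau.
have D2 : exists2 v, v \in tau & (k0 \in surviving a u v) /\
    forall w, w \in tau -> k0 \in surviving a u w ->
      surviving a u v \subset surviving a u w.
  have uP : (u \in tau) && (k0 \in surviving a u u).
    by rewrite utau surviving_refl inE.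
  have [v /andP[vtau k0v] vmin] := @arg_minnP _ u
    (fun v => (v \in tau) && (k0 \in surviving a u v))
    (fun v => #|surviving a u v|) uP.
  exists v => //; split=> // w wtau k0w.
  have := vmin w; rewrite wtau => /(_ k0w) vw.
  have /orP[//|wv] := surviving_chain chn utau vtau wtau.
  by have /eqP-> : surviving a u w == surviving a u v by rewrite eqEcard wv.
(* If k0 survives towards every vertex, [B] is empty and all the pivots lie outside it; their number
   is then the dimension. *)
have D1 : exists2 B : {set 'I_d}, [/\ forall k, block a tau k k0 -> k \notin B,
      forall w, w \in tau -> k0 \notin surviving a u w -> surviving a u w \subset B &
      forall w, w \in tau -> k0 \in surviving a u w -> B \subset surviving a u w] &
    #|pivots E u :\: B| = #|pivots E' u :\: B|.
  have [/exists_inP[v0 v0tau k0v0]|/exists_inPn none] :=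
      boolP [exists v in tau, k0 \notin surviving a u v]; last first.
    exists set0; last by rewrite !finset.setD0 !card_pivotsE dimE.
    split=> [k _|w wtau k0w|w _ _]; rewrite ?inE ?sub0set //.
    by have := none w wtau; rewrite k0w.
  have v0P : (v0 \in tau) && (k0 \notin surviving a u v0) by rewrite v0tau.
  have [v /andP[vtau k0v] vmax] := @arg_maxnP _ v0
    (fun v => (v \in tau) && (k0 \notin surviving a u v))
    (fun v => #|surviving a u v|) v0P.
  exists (surviving a u v); [split=> [k kk0|w wtau k0w|w wtau k0w]|].
  - by rewrite (block_surviving utau vtau kk0).
  - have := vmax w; rewrite wtau => /(_ k0w) wv.
    have /orP[//|vw] := surviving_chain chn utau wtau vtau.
    by have /eqP-> : surviving a u v == surviving a u w by rewrite eqEcard vw.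
  - have /orP[//|/subsetP/(_ _ k0w)] := surviving_chain chn utau vtau wtau.
    by rewrite (negbTE k0v).
  have := card_pivots_killed E utau vtau; have := card_pivots_killed E' utau vtau.
  by rewrite dimE // rankE //; lia.
have [B [Bk0 Bmax Bsub] BE] := D1; have [v vtau [k0v vmin]] := D2.
have main E1 : #|[set k in pivots E1 u | block a tau k k0]| =
    (#|pivots E1 u :\: B| - #|pivots E1 u :\: surviving a u v|)%N.
  rewrite -cardsDS; last by apply: finset.setDS; apply: Bsub.
  apply: eq_card => k; rewrite [LHS]in_set !in_setD.
  case: (k \in pivots E1 u); rewrite ?andbF //= !andbT negbK.
  apply/idP/andP => [kk0|[kv kB]].
    by rewrite (block_surviving utau vtau kk0) k0v Bk0.
  apply: (surviving_block chn utau) => w wtau.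
  have [k0w|k0w] := boolP (k0 \in surviving a u w).
    by apply: (subsetP (vmin w wtau k0w)).
  by apply: contraNF kB; apply/subsetP/Bmax.
have := card_pivots_killed E utau vtau; have := card_pivots_killed E' utau vtau.
by rewrite !main BE dimE // rankE //; lia.
Qed.

Lemma pivots_match : exists s : 'S_d, forall k, block a tau k (s k) /\
  forall u, u \in tau -> (s k \in pivots E' u) = (k \in pivots E u).
Proof.
pose rep k := odflt k [pick l | block a tau k l].
have repP k : block a tau k (rep k).
  by rewrite /rep; case: pickP => [l|/(_ k)]; rewrite ?block_refl.
have rep_block k l : (rep k == rep l) = block a tau k l.
  apply/eqP/idP => [e|kl].
    by apply: block_trans (repP k) _; rewrite e block_sym.
  rewrite /rep (eq_pick (Q := block a tau l)); last first.
    move=> m; apply/idP/idP; apply: block_trans => //; by rewrite block_sym.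
  by case: pickP => // /(_ l); rewrite block_refl.
(* A member consists of all earlier blocks, ordered by their representatives, together with, for
   [Some u], the pivots at u in the current block. The members with [None] force blocks to be
   preserved. Inside a block the pivot sets are nested, since the whole block survives in one
   direction between any two vertices. *)
pose X E1 (i : 'I_d * option V) := [set k | (rep k < i.1)%N ||
  (rep k == i.1 :> nat) && (if i.2 is Some u then (u \in tau) && (k \in pivots E1 u)
                     else false)].
have chX E1 : linked_on E1 -> chain (X E1).
  move=> lnk1 [s o] [s' o']; apply/orP.
  have [|/subsetPn[k]] := boolP (X E1 (s, o) \subset X E1 (s', o')); first by left.
  have [|/subsetPn[l]] := boolP (X E1 (s', o') \subset X E1 (s, o)); first by right.
  rewrite !inE /= => lX lX' kX kX'; exfalso.
  have le1 (m n : nat) (p : bool) : (m < n)%N || (m == n) && p -> (m <= n)%N.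
    by case: ltngtP.
  have le2 (m n : nat) (p : bool) : ~~ ((m < n)%N || (m == n) && p) -> (n <= m)%N.
    by case: ltngtP.
  have := (le1 _ _ _ lX, le2 _ _ _ lX', le1 _ _ _ kX, le2 _ _ _ kX').
  case=> -[[ls' sl] ks] s'k.
  have ss' : s = s' by apply: val_inj => /=; lia.
  rewrite -{s'}ss' in lX kX' s'k ls'.
  have [rk rl] : rep k = s /\ rep l = s by split; apply: val_inj => /=; lia.
  move: lX lX' kX kX'; rewrite rk rl ltnn eqxx /=.
  case: o o' => [u|] [v|] // /andP[vtau lv] lu /andP[utau ku].
  rewrite vtau => kv; rewrite utau /= in lu.
  have kl : block a tau k l by rewrite -rep_block rk rl.
  have := surviving_total chn k utau vtau => /orP[kS|kS].
    by rewrite (pivots_surviving lnk1 utau vtau ku kS) in kv.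
  rewrite (block_surviving vtau utau kl) in kS.
  by rewrite (pivots_surviving lnk1 vtau utau lv kS) in lu.
have [s sP] : exists s : 'S_d, forall i k, (s k \in X E' i) = (k \in X E i).
  apply: chain_perm; [exact: chX|exact: chX|] => -[t o].
  pose T E1 := [set k | (rep k == t :> nat) &&
     (if o is Some u then (u \in tau) && (k \in pivots E1 u) else false)].
  have XE E1 : #|X E1 (t, o)| = (#|[set k | (rep k < t)%N]| + #|T E1|)%N.
    rewrite -cardsUI (_ : _ :&: _ = set0) ?cards0 ?addn0; last first.
      by apply/setP => k; rewrite !inE; case: eqP => [->|]; rewrite ?ltnn ?andbF.
    by apply: eq_card => k; rewrite !inE.
  rewrite !XE; congr (_ + _)%N; rewrite /T.
  case: o {XE T} => [u|]; last by apply: eq_card => k; rewrite !inE andbF.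
  have [utau|nu] := boolP (u \in tau); last first.
    by apply: eq_card => k; rewrite !inE andbF.
  have [/existsP[k0 /eqP/val_inj k0t]|/existsPn none] := boolP [exists k, rep k == t :> nat].
    have TE E1 : [set k | (rep k == t :> nat) && (true && (k \in pivots E1 u))] =
        [set k in pivots E1 u | block a tau k k0].
      by apply/setP => k; rewrite !inE -rep_block k0t andbC -val_eqE.
    by rewrite !TE; apply: card_pivots_block.
  by apply: eq_card => k; rewrite !inE (negbTE (none k)).
have repE k : rep (s k) = rep k.
  have := sP (rep k, None) k; have := sP (rep (s k), None) k.
  rewrite !inE /= !andbF !orbF !ltnn => h1 h2; apply: val_inj => /=; lia.
exists s => k; split; first by rewrite -rep_block repE.
move=> u utau; have := sP (rep k, Some u) k.
by rewrite !inE /= repE ltnn eqxx utau /= ?inE => ->.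
Qed.

(** Rows of one block are subject to the same survival conditions, so permuting rows of A inside
    blocks permutes the rows of every [frame_matrix]. *)
Lemma frame_relabel J J' (s : 'S_d) :
    (forall k, block a tau k (s k)) ->
    (forall u k, u \in tau -> (s k \in J' u) = (k \in J u)) ->
  frame E' J' -> frame E' J.
Proof.
move=> sblk sJ [A AP]; exists (row_perm s A) => v vtau.
have [Gu GJ GE] := AP v vtau.
have GE' : frame_matrix (row_perm s A) v = row_perm s (frame_matrix A v).
  apply/matrixP => k l; rewrite !mxE; congr (if _ then _ else _).
  have /blockP bk := sblk k.
  by apply/forall_inP/forall_inP => h u utau; have := h u utau;
    have := bk u v utau vtau; lia.
split.
- by rewrite GE' row_permE unitmx_mul unitmx_perm.
- rewrite -GJ -(card_imset _ (@perm_inj _ s)); apply: eq_card => k.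
  by rewrite -[k](permKV s) sJ // mem_imset //; apply: perm_inj.
move=> k kJ; rewrite GE' (_ : row k _ = row (s k) (frame_matrix A v)).
  by apply: GE; rewrite sJ.
by apply/rowP => l; rewrite !mxE.
Qed.

Lemma equal_ranks_frame : tau != set0 -> frame E' (pivots E).
Proof.
move=> tau0; have [s sP] := pivots_match.
apply: (frame_relabel (s := s) _ _ (pivots_frame tau0 lnk')) => [k|u k utau].
  by have [] := sP k.
by have [_ ->] := sP k.
Qed.

End EqualRanks.

End Frames.

(* Imported only now because it shadows names of finset and fintype. *)
From mathcomp Require Import classical_sets.
Local Open Scope classical_set_scope.
Local Open Scope ring_scope.

(** * Lattices in an apartment *)

Lemma exprz_mulD (F : fieldType) (x y z : F) (m n : int) : x != 0 ->
  (y * x ^ m) * (z * x ^ n) = (y * z) * x ^ (m + n).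
Proof. by move=> x0; rewrite expfzDr //; ring. Qed.

Lemma exprz_cancel (F : fieldType) (x c : F) (i j m n : int) :
    x != 0 -> c != 0 ->
  (x ^ i * (c^-1 * x ^ j)) * (x ^ m * (c * x ^ n)) = x ^ (i + j + m + n).
Proof. by move=> x0 c0; rewrite !expfzDr // -[RHS]mul1r -(mulVf c0); ring. Qed.

Section ApartmentLattices.
Variables (R : idomainType) (pi : R).
Local Notation K := {fraction R}.

Definition integral (x : K) := exists s : R, x = s%:F.

Lemma integralD x y : integral x -> integral y -> integral (x + y).
Proof. by move=> [s ->] [t ->]; exists (s + t); rewrite tofracD. Qed.

Lemma integralM x y : integral x -> integral y -> integral (x * y).
Proof. by move=> [s ->] [t ->]; exists (s * t); rewrite tofracM. Qed.

Lemma tofrac_inj : injective (@FracField.tofrac R).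
Proof. by move=> x y /eqP; rewrite tofrac_eq => /eqP. Qed.

(* What is left of the valuation: [pi] is a nonzero nonunit. *)
Hypothesis pi_neq0 : pi != 0.
Hypothesis pi_exp_ge0 : forall z : int, integral (pi%:F ^ z) -> 0 <= z.

Lemma piF_neq0 : pi%:F != 0.
Proof. by rewrite tofrac_eq0. Qed.
Local Hint Resolve piF_neq0 : core.

Lemma piF_exp_neq0 (z : int) : pi%:F ^ z != 0.
Proof. by rewrite expfz_neq0. Qed.

Lemma integral_exp (z : int) : 0 <= z -> integral (pi%:F ^ z).
Proof. by case: z => // n _; exists (pi ^+ n); rewrite tofracXn. Qed.

Lemma integral_expD (m n : int) x : m <= n ->
  integral (pi%:F ^ m * x) -> integral (pi%:F ^ n * x).
Proof.
move=> mn xP; rewrite -(subrK m n) expfzDr // -mulrA.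
by apply: integralM => //; apply: integral_exp; rewrite subr_ge0.
Qed.

Variables (d : nat) (e : 'M[K]_d).
Hypothesis e_unit : e \in unitmx.
Local Notation L := (apartment_lattice pi e).
Implicit Types a b : 'rV[int]_d.

Lemma scaled_basis_mxE a : \matrix_(k < d) scaled_basis pi e a k =
  diag_mx (\row_k pi%:F ^ (- a 0 k)) *m e.
Proof.
by apply/row_matrixP => k; rewrite rowK row_mul row_diag_mx -scalemxAl -rowE mxE.
Qed.

Lemma apartment_latticeP a x :
  L a x <-> forall k, integral (pi%:F ^ a 0 k * (x *m invmx e) 0 k).
Proof.
rewrite /apartment_lattice /lspan scaled_basis_mxE; split=> [[c _ <-] k|h].
  rewrite mulmxA mulmxK // mul_mx_diag !mxE mulrCA -expfzDr // subrr mulr1.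
  by exists (c 0 k).
have /choice[c cP] := h; exists (\row_k c k) => //.
rewrite mulmxA -[RHS](mulmxKV e_unit); congr (_ *m e).
move: (x *m invmx e) cP => y cP; apply/rowP => k.
by rewrite mul_mx_diag !mxE -cP mulrAC -expfzDr // subrr mul1r.
Qed.

Lemma is_lattice_apartment a : is_lattice (L a).
Proof.
exists (\matrix_k scaled_basis pi e a k); last by [].
rewrite scaled_basis_mxE unitmx_mul e_unit andbT unitmxE det_diag unitfE; apply/prodf_neq0 => k _.
by rewrite mxE piF_exp_neq0.
Qed.

Lemma scaled_basis_coord a k l :
  (scaled_basis pi e a k *m invmx e) 0 l = pi%:F ^ (- a 0 k) * (k == l)%:R.
Proof. by rewrite /scaled_basis -scalemxAl -row_mul mulmxV // !mxE. Qed.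

Lemma scaled_basis_mem a k : L a (scaled_basis pi e a k).
Proof.
apply/apartment_latticeP => l; rewrite scaled_basis_coord mulrA.
have [->|_] := eqVneq k l; last by exists 0; rewrite mulr0 tofrac0.
by exists 1; rewrite -expfzDr // subrr mulr1 tofrac1.
Qed.

Lemma apartment_lattice_le a b : L a `<=` L b <-> forall k, a 0 k <= b 0 k.
Proof.
split=> [ab k|ab x /apartment_latticeP h]; last first.
  by apply/apartment_latticeP => k; apply: integral_expD (h k).
have /ab/apartment_latticeP/(_ k) := scaled_basis_mem a k.
rewrite scaled_basis_coord eqxx mulr1 -expfzDr // => /pi_exp_ge0.
by rewrite subr_ge0.
Qed.

Let scaled_rowE (c : K) (x : 'rV[K]_d) k : (c *: x) 0 k = c * x 0 k.
Proof. by rewrite mxE. Qed.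

Lemma shift_constE a (n : int) k : (a - const_mx n) 0 k = a 0 k - n.
Proof. by rewrite !mxE. Qed.

Lemma dilate_apartment (n : int) a :
  dilate (pi%:F ^ n) (L a) = L (a - const_mx n).
Proof.
apply/seteqP; split=> [_ [x /apartment_latticeP h <-]|x /apartment_latticeP h].
  apply/apartment_latticeP => k; rewrite -scalemxAl scaled_rowE.
  by rewrite shift_constE mulrA -expfzDr // subrK.
exists (pi%:F ^ (- n) *: x); last first.
  by rewrite scalerA -expfzDr // subrr scale1r.
apply/apartment_latticeP => k; have := h k.
by rewrite -scalemxAl scaled_rowE shift_constE mulrA -expfzDr.
Qed.

Lemma dilate_apartment_le (n : int) a b :
  dilate (pi%:F ^ n) (L a) `<=` L b <-> forall k, a 0 k - b 0 k <= n.
Proof.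
rewrite dilate_apartment apartment_lattice_le.
by split=> h k; have := h k; rewrite shift_constE; lia.
Qed.

Lemma min_exponentE a b k :
    (forall l, a 0 l - b 0 l <= a 0 k - b 0 k) ->
  min_exponent pi (L a) (L b) = a 0 k - b 0 k.
Proof.
move=> kmax; rewrite /min_exponent; apply: xget_unique => /=.
  by split=> [|m]; rewrite dilate_apartment_le.
move=> m []; rewrite dilate_apartment_le => hm /(_ (a 0 k - b 0 k)).
rewrite dilate_apartment_le => /(_ kmax); have := hm k; lia.
Qed.

Lemma apartment_latticeI a b :
  L a `&` L b = L (\row_k Num.min (a 0 k) (b 0 k)).
Proof.
apply/seteqP; split=> [x [/apartment_latticeP xa /apartment_latticeP xb]|x].
  apply/apartment_latticeP => k; rewrite mxE.
  by case: leP => _; [apply: xa|apply: xb].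
move=> /apartment_latticeP h; split; apply/apartment_latticeP => k;
  by apply: integral_expD (h k); rewrite mxE ge_min lexx ?orbT.
Qed.

Lemma homothety_class_refl (M : set 'rV[K]_d) : homothety_class M M.
Proof.
exists 1; first exact: oner_neq0.
apply/seteqP; split=> [_ [x Mx <-]|x Mx]; first by rewrite scale1r.
by exists x; rewrite // scale1r.
Qed.

Lemma homothety_class_dilate (c : K) (M : set 'rV[K]_d) : c != 0 ->
  homothety_class M (dilate c M).
Proof. by move=> c0; exists c. Qed.

Lemma homothety_class_apartment a b (n : int) :
    (forall k, a 0 k - b 0 k = n) ->
  homothety_class (L a) = homothety_class (L b).
Proof.
move=> ab.
suff half a' b' m : (forall k, a' 0 k - b' 0 k = m) ->
    homothety_class (L a') `<=` homothety_class (L b').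
  apply/seteqP; split; first exact: half ab.
  by apply: (half b a (- n)) => k; rewrite -(ab k) opprB.
move=> {ab} ab _ [c /= c0 <-].
have -> : a' = b' - const_mx (- m).
  by apply/rowP => k; rewrite shift_constE -(ab k); lia.
rewrite -dilate_apartment; exists (c * pi%:F ^ (- m)) => /=.
  by rewrite mulf_neq0 // piF_exp_neq0.
apply/seteqP; split=> [_ [x Lx <-]|_ [_ [x Lx <-] <-]].
  by exists (pi%:F ^ (- m) *: x); [exists x|rewrite scalerA].
by exists x => //; rewrite scalerA.
Qed.

(** The homothety factor c is unknown, so both inclusions are tested on basis vectors, one at k and
    one at l. In the product of the two integrality conditions c cancels and a power of pi
    remains. *)
Lemma homothety_class_apartment_inj a b :
    homothety_class (L a) = homothety_class (L b) ->
  forall k l, a 0 k - b 0 k = a 0 l - b 0 l.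
Proof.
move=> ab.
have [c /= c0 cE] : homothety_class (L b) (L a) by rewrite -ab; apply: homothety_class_refl.
have key k l : 0 <= (a 0 k - b 0 k) - (a 0 l - b 0 l).
  apply: pi_exp_ge0.
  have sE (m : K) a' k' : ((m *: scaled_basis pi e a' k') *m invmx e) 0 k' =
      m * pi%:F ^ (- a' 0 k').
    by rewrite -(scalemxAl m) scaled_rowE scaled_basis_coord eqxx mulr1.
  have /apartment_latticeP/(_ k) : L a (c *: scaled_basis pi e b k).
    by rewrite -cE; exists (scaled_basis pi e b k); first exact: scaled_basis_mem.
  have [x Lx xE] : dilate c (L b) (scaled_basis pi e a l).
    by rewrite cE; apply: scaled_basis_mem.
  have /apartment_latticeP/(_ l) := Lx.
  have -> : x = c^-1 *: scaled_basis pi e a l by rewrite -xE scalerA mulVf ?scale1r.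
  rewrite (sE c^-1 a l) (sE c b k) => h1 h2; have := integralM h1 h2.
  by rewrite exprz_cancel //; congr integral; congr (_ ^ _); lia.
by move=> k l; have := key k l; have := key l k; lia.
Qed.

End ApartmentLattices.

Lemma dvr_uniformizer_exp (R : idomainType) (pi : R) :
  dvr_with_uniformizer pi -> forall z : int, integral (pi%:F ^ z) -> 0 <= z.
Proof.
move=> [pi0 [v [vM _ vR vpi]]] z.
have piF0 : pi%:F != 0 by rewrite tofrac_eq0.
have vX n : v (pi%:F ^+ n.+1) = n.+1%:Z.
  elim: n => [|n IHn]; first by rewrite expr1.
  by rewrite exprS vM ?expf_neq0 // vpi IHn; lia.
have v1 : v 1 = 0.
  have := vM 1 1 (oner_neq0 _) (oner_neq0 _); rewrite mulr1; lia.
have vz : v (pi%:F ^ z) = z.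
  case: z => [[|n]|n]; [by rewrite expr0z v1|by rewrite -exprnP vX|].
  rewrite [X in v X](_ : _ = (pi%:F ^+ n.+1)^-1) //.
  have p0 : pi%:F ^+ n.+1 != 0 by rewrite expf_neq0.
  have := vM _ _ (invr_neq0 p0) p0.
  by rewrite vX mulVf // v1 NegzE; lia.
by move=> /(vR _ (expfz_neq0 z piF0)); rewrite vz.
Qed.

(** * Parahoric orbits *)

Section PowerSeriesUnits.
Variable F : fieldType.
Local Notation S := (powerSeries F).
Local Notation t := (ps_var F).
Implicit Types s : S.

Definition ps_const (s : S) : F := s 0%N.

Fact ps_const_zmod_morphism : zmod_morphism ps_const.
Proof. by []. Qed.
Fact ps_const_monoid_morphism : monoid_morphism ps_const.
Proof. by split=> [|s s'] //; rewrite /ps_const /= big_ord1. Qed.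

HB.instance Definition _ :=
  GRing.isZmodMorphism.Build S F ps_const ps_const_zmod_morphism.
HB.instance Definition _ :=
  GRing.isMonoidMorphism.Build S F ps_const ps_const_monoid_morphism.

Definition ps_of_const (c : F) : S := PowerSeries (fun n => if n == 0%N then c else 0).

Lemma ps_varM s n : (t * s) n = if n is m.+1 then s m else 0.
Proof.
case: n => [|n]; rewrite /= big_ord_recl /= mul0r add0r ?big_ord0 //.
by rewrite big_ord_recl /= mul1r big1 ?addr0 ?subn1 // => i _; rewrite mul0r.
Qed.

Lemma ps_const_eq0 s : ps_const s = 0 -> exists s', s = t * s'.
Proof.
move=> s0; exists (PowerSeries (fun n => s n.+1)).
by apply: powerSeriesP => -[|n]; rewrite ps_varM.
Qed.

(** Once the constant term is normalized to 1, the inverse is a geometric series in y, which is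
    divisible by t: coefficient n no longer changes from the partial sum [p n.+1] on. *)
Lemma ps_unitE s : (s \is a GRing.unit) = (ps_const s != 0).
Proof.
apply/idP/idP => [us|s0].
  apply: contraTneq (oner_neq0 F) => s0; rewrite negbK.
  by rewrite -(rmorph1 ps_const) -(mulVr us) rmorphM /= s0 mulr0.
suff key s1 : ps_const s1 = 1 -> s1 \is a GRing.unit.
  have : ps_of_const (ps_const s)^-1 * s \is a GRing.unit.
    by apply: key; rewrite rmorphM; apply: mulVf.
  by rewrite unitrM => /andP[].
move=> s1E; pose y := 1 - s1.
have [y' yE] : exists y', y = t * y'.
  by apply: ps_const_eq0; rewrite rmorphB rmorph1 /= s1E subrr.
have yX n k : (k < n)%N -> (y ^+ n) k = 0.
  rewrite yE exprMn; elim: n k (y' ^+ n) => // n IHn [|k] w kn.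
    by rewrite exprS -mulrA ps_varM.
  by rewrite exprS -mulrA ps_varM IHn.
pose p n := \sum_(i < n) y ^+ i.
have pD n k m : (k < n)%N -> p (n + m)%N k = p n k.
  move=> kn; elim: m => [|m IHm]; first by rewrite addn0.
  rewrite addnS /p big_ord_recr /= -/(p (n + m)%N).
  by rewrite yX ?addr0 //; apply: leq_trans kn (leq_addr _ _).
apply/asboolP; exists (PowerSeries (fun n => p n.+1 n)).
apply: powerSeriesP => n.
have -> : (PowerSeries (fun n => p n.+1 n) * s1) n = (p n.+1 * s1) n.
  apply: eq_bigr => i _ /=; congr (_ * _).
  by rewrite -(pD i.+1 i (n - i)%N) // addSn subnKC // -ltnS.
have -> : p n.+1 * s1 = 1 - y ^+ n.+1.
  by rewrite -[RHS]opprB subrX1 -mulNr opprB mulrC /y opprB addrC subrK.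
by rewrite [LHS]/= yX ?subr0.
Qed.

Lemma ps_var_neq0 : t != 0.
Proof.
apply: contraTneq (oner_neq0 F) => t0; rewrite negbK.
by rewrite (_ : 1 = t 1%N) // t0.
Qed.

End PowerSeriesUnits.


(** * Matrices over the power series ring acting on coordinate lattices *)

Section LatticeCoordinates.
Variables (F : fieldType) (d : nat).
Local Notation S := (powerSeries F).
Local Notation K := {fraction S}.
Local Notation t := (ps_var F).
Implicit Types (a b : 'rV[int]_d) (x : 'rV[K]_d) (c : 'rV[S]_d).
Implicit Types (g : 'M[K]_d) (N : 'M[S]_d) (U : {vspace 'rV[F]_d}).

Let tF_neq0 : t%:F != 0. Proof. by rewrite tofrac_eq0 ps_var_neq0. Qed.
Local Hint Resolve tF_neq0 : core.

Definition lattice_coords a x c := forall k, x 0 k = t%:F ^ (- a 0 k) * (c 0 k)%:F.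

Lemma LambdaP a x : Lambda a x <-> exists c, lattice_coords a x c.
Proof.
have h := apartment_latticeP (ps_var_neq0 F) (unitmx1 K d) a x.
rewrite invmx1 mulmx1 in h; split=> [/h/choice[c cP]|[c cP]]; last apply/h => k.
  by exists (\row_k c k) => k; rewrite mxE -cP mulrA -expfzDr // addNr mul1r.
by exists (c 0 k); rewrite cP mulrA -expfzDr // subrr mul1r.
Qed.

(* The preimage in [Lambda a] of a subspace of [Lambda a / t Lambda a]. *)
Definition lift_space a U : set 'rV[K]_d :=
  [set x | exists2 c, lattice_coords a x c & map_mx (@ps_const F) c \in U].

(** N is the matrix of g from the basis t^(- a k) e_k of Lambda a to the basis t^(- b l) e_l of
    Lambda b. *)
Definition represents a b g N :=
  forall k l, g k l = t%:F ^ (a 0 k - b 0 l) * (N k l)%:F.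

Lemma represents_coords a b g N x c : represents a b g N ->
  lattice_coords a x c -> lattice_coords b (x *m g) (c *m N).
Proof.
move=> gN xc l; rewrite !mxE (big_morph _ (@tofracD _) (@tofrac0 _)) mulr_sumr.
apply: eq_bigr => k _; rewrite xc gN tofracM.
rewrite [in RHS](_ : - b 0 l = - a 0 k + (a 0 k - b 0 l)); last by lia.
by rewrite !(mulrC (_ ^ _)) exprz_mulD // mulrC.
Qed.

Lemma represents_translate a b g N : represents a b g N ->
  translate g (Lambda a) `<=` Lambda b.
Proof.
move=> gN _ [x /LambdaP[c xc] <-]; apply/LambdaP.
by exists (c *m N); apply: represents_coords xc.
Qed.

Lemma translate_represents a b g :
  translate g (Lambda a) `<=` Lambda b -> exists N, represents a b g N.
Proof.
move=> gab.
have /choice[N NP] k : exists n : 'rV[S]_d,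
    forall l, g k l = t%:F ^ (a 0 k - b 0 l) * (n 0 l)%:F.
  have : Lambda b (t%:F ^ (- a 0 k) *: row k g).
    apply: gab; exists (t%:F ^ (- a 0 k) *: delta_mx 0 k).
      apply/LambdaP; exists (delta_mx 0 k) => l; rewrite !mxE eqxx /=.
      by case: eqVneq => [->|_]; rewrite ?tofrac1 ?tofrac0 // !mulr0.
    by rewrite -scalemxAl -rowE.
  move=> /LambdaP[n nP]; exists n => l; have := nP l.
  rewrite !mxE => /(congr1 ( *%R (t%:F ^ a 0 k))).
  by rewrite !mulrA -!expfzDr // subrr mul1r.
by exists (\matrix_k N k) => k l; rewrite mxE.
Qed.

Lemma representsM a b b' g g' N N' :
  represents a b g N -> represents b b' g' N' ->
  represents a b' (g *m g') (N *m N').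
Proof.
move=> gN gN' k l; rewrite !mxE (big_morph _ (@tofracD _) (@tofrac0 _)) mulr_sumr.
apply: eq_bigr => m _; rewrite gN gN' tofracM.
rewrite [in RHS](_ : a 0 k - b' 0 l = a 0 k - b 0 m + (b 0 m - b' 0 l)); last by lia.
by rewrite !(mulrC (_ ^ _)) exprz_mulD // mulrC.
Qed.

Lemma represents_inv a g N : N \in unitmx -> represents a a g N ->
  represents a a (invmx g) (invmx N).
Proof.
move=> uN gN.
pose h : 'M[K]_d := \matrix_(k, l) (t%:F ^ (a 0 k - a 0 l) * (invmx N k l)%:F).
have hN : represents a a h (invmx N) by move=> k l; rewrite mxE.
suff gh : g *m h = 1%:M.
  suff -> : invmx g = h by [].
  have [ug _] := mulmx1_unit gh.
  by rewrite -[LHS]mulmx1 -gh mulKmx.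
apply/matrixP => k l; rewrite (representsM gN hN) mulmxV // !mxE.
by case: eqVneq => [->|_]; rewrite ?subrr ?tofrac1 ?tofrac0 ?mulr1 ?mulr0.
Qed.

Lemma represents_det a g N : represents a a g N -> \det g = (\det N)%:F.
Proof.
move=> gN.
have -> : g = diag_mx (\row_k t%:F ^ a 0 k) *m
    (map_mx (@FracField.tofrac S) N *m diag_mx (\row_k t%:F ^ (- a 0 k))).
  apply/matrixP => k l; rewrite mul_diag_mx mul_mx_diag !mxE gN expfzDr //; ring.
rewrite !det_mulmx !det_diag mulrC -mulrA -big_split /= big1 ?mulr1 ?det_map_mx //.
by move=> k _; rewrite !mxE -expfzDr // addNr.
Qed.

Lemma dim_lker_coord_proj (D : {set 'I_d}) :
  \dim (lker (coord_proj F (~: D))) = #|D|.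
Proof.
(* An order in which D comes first, so that [card_pivots] applies to the full space, all of whose
   coordinates are pivots. *)
pose key (k : 'I_d) : int := if k \in D then k%:Z else d%:Z + k%:Z.
have key_inj : injective key.
  move=> k l; rewrite /key => kl; apply: val_inj => /=.
  have := ltn_ord k; have := ltn_ord l; move: kl.
  by do 2 case: ifP => _; lia.
have := @card_pivots F d key key_inj fullv D; rewrite capfv => <-; last first.
  move=> k l kD; rewrite /key kD; case: ifP => // _ lk.
  by have := ltn_ord k; lia.
apply: eq_card => k; rewrite !inE; case: (k \in D) => //=.
apply/asboolP; exists (delta_mx 0 k); rewrite memvf mxE !eqxx; split=> // l kl.
by rewrite mxE eqxx /=; case: eqVneq kl => // ->; rewrite ltxx.
Qed.

Lemma coord_image_eq (C : 'M[F]_d) U (D : {set 'I_d}) y :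
    C \in unitmx -> #|D| = \dim U -> (forall k, k \in D -> row k C \in U) ->
  (y *m C \in U) = [forall k in ~: D, y 0 k == 0].
Proof.
move=> uC DU CU.
pose f : 'End('rV[F]_d) := linfun (mulmxr C).
have fE z : f z = z *m C by rewrite lfunE.
have f_inj : lker f == 0%VS.
  apply/lker0P => z z'; rewrite !fE => /(congr1 (mulmx^~ (invmx C))).
  by rewrite !mulmxK.
have fU : (f @: lker (coord_proj F (~: D)) = U)%VS.
  apply/eqP; rewrite eqEdim limg_dim_eq; last first.
    by apply/eqP; rewrite (eqP f_inj) capv0.
  rewrite dim_lker_coord_proj DU leqnn andbT; apply/subvP => _ /memv_imgP[z zD ->].
  rewrite fE mulmx_sum_row; apply: memv_suml => k _.
  have [kD|kD] := boolP (k \in D); first by rewrite memvZ // CU.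
  move: zD; rewrite mem_lker_coord_proj => /forall_inP zD.
  by rewrite (eqP (zD k _)) ?scale0r ?mem0v // inE.
rewrite -mem_lker_coord_proj -fU -fE; apply/idP/idP => [|yD]; last exact: memv_img.
by move=> /memv_imgP[z zD] /(lker0P f_inj) ->.
Qed.

(** Modulo t, g maps the coordinate subspace of D onto U. In these coordinates the preimage of U has
    entries divisible by t outside D, which absorbs the factor t^-1; inside D this factor accounts
    for b = a + 1. *)
Lemma lift_space_translate a b g N U (D : {set 'I_d}) :
    represents a a g N -> N \in unitmx ->
    (forall k, b 0 k = a 0 k + (k \in D)%:Z) -> #|D| = \dim U ->
    (forall k, k \in D -> row k (map_mx (@ps_const F) N) \in U) ->
  dilate t%:F^-1 (lift_space a U) = translate g (Lambda b).
Proof.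
move=> gN uN bE DU NU; set C := map_mx _ N in NU.
have uC : C \in unitmx by rewrite unitmxE det_map_mx rmorph_unit // -unitmxE.
have CU y := coord_image_eq y uC DU NU.
have ug : g \in unitmx.
  rewrite unitmxE (represents_det gN) unitfE tofrac_eq0.
  by apply: contraTneq uN => N0; rewrite unitmxE N0 unitr0.
apply/seteqP; split=> [_ [x [c xc cU] <-]|_ [y /LambdaP[c yc] <-]].
  have xc' := represents_coords (represents_inv uN gN) xc.
  set c' := c *m _ in xc'.
  have c'0 k : k \notin D -> ps_const (c' 0 k) = 0.
    have : map_mx (@ps_const F) c' *m C \in U.
      by rewrite -map_mxM /c' mulmxKV.
    rewrite CU => /forall_inP h kD; have := h k; rewrite inE kD mxE => /(_ isT).
    by move/eqP.
  exists (t%:F^-1 *: (x *m invmx g)); last by rewrite -scalemxAl mulmxKV.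
  have /choice[c'' c''P] k : exists s, t%:F ^ (- (k \in D)%:Z + 1) * s%:F = (c' 0 k)%:F.
    have [kD|/c'0/ps_const_eq0[s ->]] := boolP (k \in D).
      by exists (c' 0 k); rewrite addNr mul1r.
    by exists s; rewrite oppr0 add0r expr1z tofracM.
  apply/LambdaP; exists (\row_k c'' k) => k; rewrite !mxE.
  have := xc' k; rewrite mxE => ->; rewrite -c''P bE.
  rewrite -exprN1 !mulrA -!expfzDr //; congr (_ ^ _ * _); lia.
exists (t%:F *: (y *m g)); last by rewrite scalerA mulVf // scale1r.
pose c' : 'rV[S]_d := \row_k (if k \in D then c 0 k else t * c 0 k).
have yc' : lattice_coords a (t%:F *: y) c'.
  move=> k; rewrite !mxE yc bE; case: (k \in D).
    rewrite mulrA -{1}[t%:F]expr1z -expfzDr //; congr (_ ^ _ * _); lia.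
  by rewrite addr0 tofracM; ring.
rewrite scalemxAl; exists (c' *m N); first exact: represents_coords yc'.
rewrite map_mxM CU; apply/forall_inP => k; rewrite inE => /negbTE kD.
by rewrite !mxE kD rmorphM /= mul0r.
Qed.

Lemma represents_translate_eq a g N : represents a a g N -> N \in unitmx ->
  translate g (Lambda a) = Lambda a.
Proof.
move=> gN uN; apply/seteqP; split; first exact: represents_translate gN.
have ug : g \in unitmx.
  rewrite unitmxE (represents_det gN) unitfE tofrac_eq0.
  by apply: contraTneq uN => N0; rewrite unitmxE N0 unitr0.
move=> x /LambdaP[c xc]; exists (x *m invmx g); last by rewrite mulmxKV.
apply/LambdaP; exists (c *m invmx N).
exact: represents_coords (represents_inv uN gN) xc.
Qed.

End LatticeCoordinates.

(** * Orbits of the stabilizer of a simplex *)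

Section Orbits.
Variables (F : fieldType) (d : nat) (V : finType).
Local Notation S := (powerSeries F).
Local Notation K := {fraction S}.
Local Notation t := (ps_var F).
Implicit Types (a b : V -> 'rV[int]_d) (tau : {set V}) (g p : 'M[K]_d).
Implicit Types (U : {vspace 'rV[F]_d}) (M : set 'rV[K]_d).

Let tF_neq0 : t%:F != 0. Proof. by rewrite tofrac_eq0 ps_var_neq0. Qed.
Local Hint Resolve tF_neq0 : core.

Lemma translateM g p M : translate p (translate g M) = translate (g *m p) M.
Proof.
apply/seteqP; split=> [_ [_ [x Mx <-] <-]|_ [x Mx <-]].
  by exists x; rewrite // mulmxA.
by exists (x *m g); [exists x|rewrite mulmxA].
Qed.

Lemma translate1 M : translate 1%:M M = M.
Proof.
apply/seteqP; split=> [_ [x Mx <-]|x Mx]; first by rewrite mulmx1.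
by exists x; rewrite // mulmx1.
Qed.

Lemma translate_dilate g (c : K) M :
  translate g (dilate c M) = dilate c (translate g M).
Proof.
apply/seteqP; split=> [_ [_ [x Mx <-] <-]|_ [_ [x Mx <-] <-]].
  by exists (x *m g); [exists x|rewrite scalemxAl].
by exists (c *: x); [exists x|rewrite scalemxAl].
Qed.

Lemma dilate_inj (c : K) M M' : c != 0 -> dilate c M = dilate c M' -> M = M'.
Proof.
move=> c0; suff half (N N' : set 'rV[K]_d) : dilate c N = dilate c N' -> N `<=` N'.
  by move=> h; apply/seteqP; split; apply: half.
move=> NN' x Nx; have : dilate c N (c *: x) by exists x.
by rewrite NN' => -[y N'y /(scalerI c0) <-].
Qed.

Lemma translateK g M : g \in unitmx -> translate (invmx g) (translate g M) = M.
Proof. by move=> ug; rewrite translateM mulmxV // translate1. Qed.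

Lemma translate_inv g M M' : g \in unitmx -> translate g M = M' ->
  translate (invmx g) M' = M.
Proof. by move=> ug <-; rewrite translateK. Qed.

Definition stabilizer a tau : set 'M[K]_d :=
  [set g | \det g = 1 /\
    forall v, v \in tau -> translate g (Lambda (a v)) = Lambda (a v)].

Lemma stabilizer_unit a tau g : stabilizer a tau g -> g \in unitmx.
Proof. by case=> g1 _; rewrite unitmxE g1 unitr1. Qed.

Lemma stabilizerM a tau g p :
  stabilizer a tau g -> stabilizer a tau p -> stabilizer a tau (g *m p).
Proof.
move=> [g1 ga] [p1 pa]; split=> [|v vtau]; first by rewrite det_mulmx g1 p1 mulr1.
by rewrite -translateM ga // pa.
Qed.

Lemma stabilizerV a tau g : stabilizer a tau g -> stabilizer a tau (invmx g).
Proof.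
move=> gP; have ug := stabilizer_unit gP; case: gP => g1 ga.
split=> [|v vtau]; first by rewrite det_inv g1 invr1.
by apply: translate_inv (ga v vtau).
Qed.

Lemma stabilizer_represents a tau g v : stabilizer a tau g -> v \in tau ->
  exists2 N, represents (a v) (a v) g N & N \in unitmx.
Proof.
move=> gP vtau; have [N gN] : exists N, represents (a v) (a v) g N.
  by apply: translate_represents; case: gP => _ ->.
exists N => //; rewrite unitmxE; have := represents_det gN.
case: gP => -> _; rewrite -tofrac1 => /tofrac_inj <-; exact: unitr1.
Qed.

Lemma lattice_coords_inj (b : 'rV[int]_d) (x : 'rV[K]_d) c c' :
  lattice_coords b x c -> lattice_coords b x c' -> c = c'.
Proof.
move=> xc xc'; apply/rowP => k; apply: tofrac_inj.
by apply: (mulfI (expfz_neq0 (- b 0 k) tF_neq0)); rewrite -xc -xc'.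
Qed.

Lemma argmax_in tau (f : V -> int) : tau != finset.set0 ->
  exists2 v, v \in tau & forall u, u \in tau -> f u <= f v.
Proof.
case/set0Pn => v0 v0tau.
by have [v vtau vmax] := @arg_maxP _ _ _ v0 (mem tau) f v0tau; exists v.
Qed.

(** The least exponents preserving all Lambda (a v) turn A into a matrix whose reduction at v is
    [frame_matrix], which is invertible. Its determinant is only a unit; rescaling one row makes it
    1 and changes no span of rows. *)
Lemma frame_orbit a tau (E : V -> {vspace 'rV[F]_d}) J :
    (0 < d)%N -> tau != finset.set0 -> frame a tau E J ->
  exists2 g, stabilizer a tau g & forall v, v \in tau ->
    dilate t%:F^-1 (lift_space (a v) (E v)) =
    translate g (Lambda (shift_on a J v)).
Proof.
move=> d0 tau0 [A AP].
have /choice[c cP] k : exists f : 'I_d -> int, forall l,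
    (exists2 w, w \in tau & f l = a w 0 k - a w 0 l) /\
    forall u, u \in tau -> a u 0 k - a u 0 l <= f l.
  suff h l : exists m, (exists2 w, w \in tau & m = a w 0 k - a w 0 l) /\
      forall u, u \in tau -> a u 0 k - a u 0 l <= m by have [f fP] := choice h; exists f.
  have [w wtau wmax] := argmax_in (fun u => a u 0 k - a u 0 l) tau0.
  by exists (a w 0 k - a w 0 l); split=> //; exists w.
pose g0 : 'M[K]_d := \matrix_(k, l) (t%:F ^ c k l * (ps_of_const (A k l))%:F).
pose N v : 'M[S]_d := \matrix_(k, l)
  (t ^+ absz (c k l - (a v 0 k - a v 0 l))%R * ps_of_const (A k l)).
have g0N v : v \in tau -> represents (a v) (a v) g0 (N v).
  move=> vtau k l; rewrite !mxE tofracM tofracXn mulrA exprnP -expfzDr //.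
  by congr (_ ^ _ * _); have [_ /(_ v vtau)] := cP k l; lia.
have constN v : v \in tau -> map_mx (@ps_const F) (N v) = frame_matrix a tau A v.
  move=> vtau; apply/matrixP => k l; rewrite !mxE rmorphM rmorphXn.
  rewrite (_ : _ (ps_of_const _) = A k l) // (_ : _ t = 0) // expr0n.
  have [[w wtau cw] cmax] := cP k l.
  case: ifP => [/forall_inP/(_ w wtau)|/negbT].
    have := cmax v vtau; rewrite -cw => h1 h2.
    by rewrite (_ : absz _ = 0%N) ?mul1r //; lia.
  rewrite negb_forall_in => /exists_inP[u utau]; rewrite -ltNge => h.
  by have := cmax u utau; case: eqP; rewrite ?mul0r //; lia.
have /set0Pn[v0 v0tau] := tau0.
have uN v : v \in tau -> N v \in unitmx.
  move=> vtau; rewrite unitmxE ps_unitE.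
  have [+ _ _] := AP v vtau; rewrite unitmxE -constN // det_map_mx unitfE.
  by [].
(* The choice of v0 does not matter: all the [N v] have the determinant of [g0]. *)
pose dl := (\det (N v0))^-1.
pose k0 := Ordinal d0.
pose D : 'rV[S]_d := \row_k (if k == k0 then dl else 1).
have DN v : v \in tau -> represents (a v) (a v)
    (diag_mx (map_mx (@FracField.tofrac S) D) *m g0) (diag_mx D *m N v).
  move=> vtau k l; rewrite !mul_diag_mx !mxE -/(N v).
  have := g0N v vtau k l; rewrite !mxE tofracM => ->.
  by rewrite mulrCA [in RHS]tofracM [in RHS]tofracM.
have udl : dl \is a GRing.unit by rewrite unitrV -unitmxE uN.
have detD : \det (diag_mx D) = dl.
  rewrite det_diag (bigD1 k0) //= big1 => [|k /negbTE kk0]; rewrite mxE ?eqxx ?mulr1 //.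
  by rewrite kk0.
have uDN v : v \in tau -> diag_mx D *m N v \in unitmx.
  by move=> vtau; rewrite unitmx_mul uN // andbT unitmxE detD.
exists (diag_mx (map_mx (@FracField.tofrac S) D) *m g0).
  split=> [|v vtau]; last exact: represents_translate_eq (DN v vtau) (uDN v vtau).
  rewrite (represents_det (DN v0 v0tau)) det_mulmx detD mulVr ?tofrac1 //.
  by rewrite -unitmxE uN.
move=> v vtau; have [_ GJ GE] := AP v vtau.
apply: (lift_space_translate (DN v vtau) (uDN v vtau) (shift_onE a J v) GJ).
move=> k kJ; rewrite map_mxM row_mul constN // map_diag_mx row_diag_mx.
by rewrite -scalemxAl -rowE memvZ // GE.
Qed.

(** The reduction of p at u is an automorphism. As p is integral in the basis at v too, its entries
    from a killed k to a surviving l are divisible by t, so the kernel of the projection is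
    preserved. The reverse inequalities come from the inverse of p. *)
Lemma stabilizer_dim_le a tau p u v U U' :
    stabilizer a tau p -> u \in tau -> v \in tau ->
    translate p (lift_space (a u) U) `<=` lift_space (a u) U' ->
  (\dim U <= \dim U')%N /\
  (\dim (U :&: lker (coord_proj F (surviving a u v))) <=
    \dim (U' :&: lker (coord_proj F (surviving a u v))))%N.
Proof.
move=> pP utau vtau pU.
have [N pN uN] := stabilizer_represents pP utau.
have [N' pN' _] := stabilizer_represents pP vtau.
set C := map_mx (@ps_const F) N.
have uC : C \in unitmx by rewrite unitmxE det_map_mx rmorph_unit // -unitmxE.
pose f : 'End('rV[F]_d) := linfun (mulmxr C).
have fE z : f z = z *m C by rewrite lfunE.
have f_inj : lker f == 0%VS.
  apply/lker0P => z z'; rewrite !fE => /(congr1 (mulmx^~ (invmx C))).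
  by rewrite !mulmxK.
have fU y : y \in U -> f y \in U'.
  move=> yU; pose c : 'rV[S]_d := \row_k ps_of_const (y 0 k).
  pose x : 'rV[K]_d := \row_k (t%:F ^ (- a u 0 k) * (c 0 k)%:F).
  have xc : lattice_coords (a u) x c by move=> k; rewrite !mxE.
  have constc : map_mx (@ps_const F) c = y by apply/rowP => k; rewrite !mxE.
  have [c' xc' c'U] : lift_space (a u) U' (x *m p).
    by apply: pU; exists x => //; exists c; rewrite ?constc.
  move: c'U; rewrite (lattice_coords_inj xc' (represents_coords pN xc)).
  by rewrite map_mxM constc fE.
have dimf (W W' : {vspace 'rV[F]_d}) : (forall y, y \in W -> f y \in W') ->
    (\dim W <= \dim W')%N.
  move=> WW'; rewrite -(limg_dim_eq (f := f)); last first.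
    by apply/eqP; rewrite (eqP f_inj) capv0.
  by apply: dimvS; apply/subvP => _ /memv_imgP[y yW ->]; apply: WW'.
split; first exact: dimf.
apply: dimf => y; rewrite !memv_cap => /andP[/fU -> /=].
rewrite !mem_lker_coord_proj => /forall_inP y0; apply/forall_inP => l lS.
rewrite fE mxE big1 // => k _.
have [kS|kS] := boolP (k \in surviving a u v); first by rewrite (eqP (y0 k kS)) mul0r.
have [m mE] : exists m : nat,
    (a v 0 k - a u 0 k) - (a v 0 l - a u 0 l) = m.+1%:Z.
  move: kS; rewrite (surviving_eq _ lS) => kS.
  have /survivingP/(_ k) := lS.
  exists (absz ((a v 0 k - a u 0 k) - (a v 0 l - a u 0 l))%R).-1; lia.
have NN' : N k l = t * (t ^+ m * N' k l).
  apply: tofrac_inj; rewrite mulrA -exprS tofracM tofracXn.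
  apply: (mulfI (expfz_neq0 (a u 0 k - a u 0 l) tF_neq0)); rewrite -pN.
  by rewrite pN' mulrA exprnP -expfzDr // -mE; congr (_ ^ _ * _); lia.
by rewrite mxE NN' rmorphM /= mul0r mulr0.
Qed.

Lemma stabilizer_rank a tau p u v U U' :
    stabilizer a tau p -> u \in tau -> v \in tau ->
    translate p (lift_space (a u) U) = lift_space (a u) U' ->
  \dim (coord_proj F (surviving a u v) @: U) =
  \dim (coord_proj F (surviving a u v) @: U').
Proof.
move=> pP utau vtau pU.
have := @stabilizer_dim_le a tau p u v U U' pP utau vtau.
rewrite pU => /(_ (fun _ => id)) [h1 h2].
have pV : translate (invmx p) (lift_space (a u) U') = lift_space (a u) U.
  exact: translate_inv (stabilizer_unit pP) pU.
have := @stabilizer_dim_le a tau _ u v U' U (stabilizerV pP) utau vtau.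
rewrite pV => /(_ (fun _ => id)) [h3 h4].
have eU : \dim U = \dim U' by apply/eqP; rewrite eqn_leq h1 h3.
have eK : \dim (U :&: lker (coord_proj F (surviving a u v))) =
    \dim (U' :&: lker (coord_proj F (surviving a u v))).
  by apply/eqP; rewrite eqn_leq h2 h4.
move: eU; rewrite -(limg_ker_dim (coord_proj F (surviving a u v)) U).
by rewrite -(limg_ker_dim (coord_proj F (surviving a u v)) U') eK => /addnI.
Qed.

(* Some term of the expansion of [\det p = 1] is not divisible by [t]: the
   exponents along the corresponding permutation are the smallest possible. *)
Lemma stabilizer_weyl a tau p (b b' : V -> 'rV[int]_d) :
    tau != finset.set0 -> stabilizer a tau p ->
    (forall v, v \in tau -> translate p (Lambda (b v)) = Lambda (b' v)) ->
    (forall v, v \in tau -> \sum_k b v 0 k = \sum_k b' v 0 k) ->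
  exists (s : 'S_d) (z : 'rV[int]_d), \sum_k z 0 k = 0 /\ forall v, v \in tau ->
    affine_transformation s z (a v) = a v /\
    affine_transformation s z (b v) = b' v.
Proof.
move=> tau0 pP pb bb'.
(* [m k l] is the best lower bound on the order in t of the entry p k l given by the stability of
   the Lambda (a v) and by the maps from Lambda (b v) to Lambda (b' v). *)
have /choice[m mP] k : exists f : 'I_d -> int, forall l,
    [/\ forall v, v \in tau -> a v 0 k - a v 0 l <= f l,
        forall v, v \in tau -> b v 0 k - b' v 0 l <= f l &
        exists n : S, p k l = t%:F ^ f l * n%:F].
  suff h l : exists m : int,
    [/\ forall v, v \in tau -> a v 0 k - a v 0 l <= m,
        forall v, v \in tau -> b v 0 k - b' v 0 l <= m &
        exists n : S, p k l = t%:F ^ m * n%:F] by have [f fP] := choice h; exists f.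
  have [v vtau vmax] := argmax_in (fun u => a u 0 k - a u 0 l) tau0.
  have [w wtau wmax] := argmax_in (fun u => b u 0 k - b' u 0 l) tau0.
  case: (leP (a v 0 k - a v 0 l) (b w 0 k - b' w 0 l)) => vw.
    exists (b w 0 k - b' w 0 l); split=> // [u utau|].
      exact: le_trans (vmax u utau) vw.
    have [N pN] : exists N, represents (b w) (b' w) p N.
      by apply: translate_represents; rewrite pb.
    by exists (N k l).
  exists (a v 0 k - a v 0 l); split=> // [u utau|].
    exact: le_trans (wmax u utau) (ltW vw).
  by have [N pN _] := stabilizer_represents pP vtau; exists (N k l).
(* Otherwise every term of the determinant has positive exponent, and 1 would be divisible by t. *)
have [s sm] : exists s : 'S_d, \sum_k m k (s k) <= 0.
  apply: contrapT => none.
  have detp : exists q : S, \det p = (t * q)%:F.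
    rewrite /determinant; elim/big_rec: _ => [|s x _ [q ->]].
      by exists 0; rewrite mulr0 tofrac0.
    suff [q' q'E] : exists q' : S, \prod_k p k (s k) = (t * q')%:F.
      rewrite q'E; exists ((-1) ^+ s * q' + q).
      by rewrite mulrDr tofracD mulrCA [in RHS]tofracM tofracXn tofracN tofrac1.
    have /choice[n nE] k : exists n : S, p k (s k) = t%:F ^ m k (s k) * n%:F.
      by have [] := mP k (s k).
    under eq_bigr do rewrite nE.
    rewrite big_split /=.
    have <- : t%:F ^ (\sum_k m k (s k)) = \prod_k t%:F ^ m k (s k).
      by apply: (big_morph (exprz t%:F)) => // x' y'; rewrite expfzDr.
    have : 1 <= \sum_k m k (s k).
      by rewrite leNgt; apply/negP => h; apply: none; exists s; rewrite -ltzD1 add0r.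
    case: (\sum_k m k (s k)) => // -[//|j] _.
    exists (t ^+ j * \prod_k n k).
    rewrite mulrA -exprS tofracM tofracXn; congr (_ * _).
    by rewrite (big_morph _ (@tofracM _) (@tofrac1 _)).
  have [q qE] := detp; case: pP => p1 _; move: qE; rewrite p1 -tofrac1.
  move=> /tofrac_inj/(congr1 (@ps_const F)); rewrite rmorph1 rmorphM /= mul0r.
  by move/eqP; rewrite oner_eq0.
(* Along s the bounds f k - f' (s k) add up to 0, while m dominates them with sum at most 0: all are
   equalities. *)
have tight (f f' : 'I_d -> int) : \sum_k f k = \sum_k f' k ->
    (forall k, f k - f' (s k) <= m k (s k)) ->
  forall k, m k (s k) = f k - f' (s k).
  move=> ff' fm; have s0 : \sum_k (m k (s k) - (f k - f' (s k))) <= 0.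
    rewrite sumrB [X in _ - X](_ : _ = 0) ?subr0 // sumrB ff'.
    by rewrite [X in X - _](reindex_inj (@perm_inj _ s)) subrr.
  have ge0 k : 0 <= m k (s k) - (f k - f' (s k)) by rewrite subr_ge0.
  have s1 : \sum_k (m k (s k) - (f k - f' (s k))) = 0.
    by apply/eqP; rewrite eq_le s0 sumr_ge0.
  by move=> k; apply/eqP; rewrite -subr_eq0; apply/eqP; apply: (psumr_eq0P _ s1).
have ma v : v \in tau -> forall k, m k (s k) = a v 0 k - a v 0 (s k).
  by move=> vtau; apply: (tight (a v 0) (a v 0)) => // k; have [h _ _] := mP k (s k); apply: h.
have mb v : v \in tau -> forall k, m k (s k) = b v 0 k - b' v 0 (s k).
  move=> vtau; apply: (tight (b v 0) (b' v 0)) => [|k]; first exact: bb'.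
  by have [_ h _] := mP k (s k); apply: h.
exists s, (\row_j (- m ((s^-1)%g j) j)); split=> [|v vtau].
  have /set0Pn[v vtau] := tau0.
  rewrite (reindex_inj (@perm_inj _ s)) /=.
  under eq_bigr do rewrite mxE permK (ma v vtau).
  by rewrite sumrN sumrB [X in X - _](reindex_inj (@perm_inj _ s)) subrr oppr0.
split; apply/rowP => j; rewrite !mxE; set k := (s^-1)%g j.
  by have := ma v vtau k; rewrite permKV; lia.
by have := mb v vtau k; rewrite permKV; lia.
Qed.

End Orbits.

(** * Strata *)

Section QuotientCoordinates.
Variables (R : idomainType) (pi : R) (kappa : fieldType).
Variables (res : {rmorphism R -> kappa}) (d : nat) (e : 'M[{fraction R}]_d).
Hypothesis pi_neq0 : pi != 0.
Hypothesis pi_exp_ge0 : forall z : int, integral (pi%:F ^ z) -> 0 <= z.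
Hypothesis hres : residue_map pi res.
Hypothesis e_unit : e \in unitmx.
Local Notation L := (apartment_lattice pi e).
Implicit Types (a b : 'rV[int]_d) (y : 'rV[kappa]_d).

Let piF0 : pi%:F != 0. Proof. by rewrite tofrac_eq0. Qed.
Local Hint Resolve piF0 : core.

Definition basis_sum a (c : 'I_d -> R) : 'rV[{fraction R}]_d :=
  \sum_k (c k)%:F *: scaled_basis pi e a k.

Lemma basis_sum_coord a c k :
  (basis_sum a c *m invmx e) 0 k = pi%:F ^ (- a 0 k) * (c k)%:F.
Proof.
rewrite mulmx_suml summxE (bigD1 k) //= big1 ?addr0 => [|l lk].
  by rewrite -scalemxAl mxE scaled_basis_coord // eqxx mulr1 mulrC.
by rewrite -scalemxAl mxE scaled_basis_coord // (negbTE lk) !mulr0.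
Qed.

Lemma mem_basis_sum a c : L a (basis_sum a c).
Proof.
apply/(apartment_latticeP pi_neq0 e_unit) => k; rewrite basis_sum_coord.
by exists (c k); rewrite mulrA -expfzDr // subrr mul1r.
Qed.

Lemma basis_sumP a x : L a x -> exists c, x = basis_sum a c.
Proof.
move=> /(apartment_latticeP pi_neq0 e_unit)/choice[c cP]; exists c.
rewrite -[LHS](mulmxKV e_unit) -[RHS](mulmxKV e_unit); congr (_ *m e).
apply/rowP => k; rewrite basis_sum_coord -cP mulrA -expfzDr // addNr mul1r //.
Qed.

Section OneLattice.
Variables (a : 'rV[int]_d) (B : lattice_quotient res pi (L a)).

Definition quot_coord_fun y : B :=
  \sum_k y 0 k *: quot_map B (scaled_basis pi e a k).

Fact quot_coord_linear : linear quot_coord_fun.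
Proof.
move=> c y z; rewrite /quot_coord_fun scaler_sumr -big_split /=.
by apply: eq_bigr => k _; rewrite !mxE scalerDl scalerA.
Qed.

HB.instance Definition _ :=
  GRing.isLinear.Build _ _ _ _ quot_coord_fun quot_coord_linear.

Definition quot_coord : 'Hom('rV[kappa]_d, B) := linfun quot_coord_fun.

Lemma quot_coordE y :
  quot_coord y = \sum_k y 0 k *: quot_map B (scaled_basis pi e a k).
Proof. by rewrite lfunE. Qed.

Lemma quot_map_basis_sum c :
  quot_map B (basis_sum a c) = quot_coord (\row_k res (c k)).
Proof.
rewrite quot_coordE.
under [RHS]eq_bigr do rewrite mxE.
(* Additivity of [quot_map] is available only on the lattice, so membership of the partial sums is
   carried through the induction. *)
have key (s : seq 'I_d) :
    L a (\sum_(k <- s) (c k)%:F *: scaled_basis pi e a k) /\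
    quot_map B (\sum_(k <- s) (c k)%:F *: scaled_basis pi e a k) =
    \sum_(k <- s) res (c k) *: quot_map B (scaled_basis pi e a k).
  elim: s => [|k s [Ls IHs]].
    rewrite !big_nil.
    have L0 : L a 0.
      apply/(apartment_latticeP pi_neq0 e_unit) => k.
      by exists 0; rewrite mul0mx mxE mulr0 tofrac0.
    by split=> //; have := @quot_mapZ _ _ _ _ _ _ B 0 0 L0; rewrite tofrac0 rmorph0 !scale0r.
  have Lk : L a ((c k)%:F *: scaled_basis pi e a k).
    apply/(apartment_latticeP pi_neq0 e_unit) => l.
    rewrite -scalemxAl mxE mulrCA; apply: integralM; first by exists (c k).
    by move: l; apply/(apartment_latticeP pi_neq0 e_unit)/scaled_basis_mem.
  rewrite !big_cons; split; last first.
    by rewrite quot_mapD // IHs quot_mapZ //; apply: scaled_basis_mem.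
  apply/(apartment_latticeP pi_neq0 e_unit) => l.
  rewrite mulmxDl mxE mulrDr; apply: integralD; move: l;
    exact/(apartment_latticeP pi_neq0 e_unit).
by have [] := key (index_enum 'I_d).
Qed.

Lemma row_res y : exists c : 'I_d -> R, y = \row_k res (c k).
Proof.
have [res_surj _] := hres.
have /choice[c cP] k : exists s, res s = y 0 k by apply: res_surj.
by exists c; apply/rowP => k; rewrite mxE cP.
Qed.

Lemma quot_coord_inj : lker quot_coord == 0%VS.
Proof.
rewrite -subv0; apply/subvP => y; rewrite memv_ker memv0 => /eqP.
have [c ->] := row_res y; rewrite -quot_map_basis_sum.
move=> /(quot_map_ker B (mem_basis_sum a c)).
rewrite -[X in dilate X](expr1z pi%:F) (dilate_apartment pi_neq0 e_unit).
move=> /(apartment_latticeP pi_neq0 e_unit) h; apply/eqP/rowP => k.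
have [s sE] := h k; rewrite !mxE; have [_ res_ker] := hres; apply/res_ker.
exists s; apply: tofrac_inj; rewrite tofracM -sE basis_sum_coord shift_constE.
rewrite !mulrA -[X in _ = X * _ * _ * _]expr1z -!expfzDr //.
by rewrite (_ : 1 + _ + _ = 0) ?mul1r //; lia.
Qed.

Lemma quot_coord_surj : limg quot_coord = fullv.
Proof.
apply/eqP; rewrite eqEsubv subvf; apply/subvP => z _.
have [x /basis_sumP[c ->] <-] := quot_map_surj z.
by rewrite quot_map_basis_sum memv_img ?memvf.
Qed.

Definition coord_space (U : {vspace B}) : {vspace 'rV[kappa]_d} :=
  (quot_coord @^-1: U)%VS.

Lemma mem_coord_space U y : (y \in coord_space U) = (quot_coord y \in U).
Proof. by rewrite -memv_preim. Qed.

Lemma coord_spaceK U : (quot_coord @: coord_space U)%VS = U.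
Proof. by apply: lpreimK; rewrite quot_coord_surj subvf. Qed.

Lemma dim_coord_space U : \dim (coord_space U) = \dim U.
Proof.
rewrite -[in RHS](coord_spaceK U) limg_dim_eq //.
by apply/eqP; rewrite (eqP quot_coord_inj) capv0.
Qed.

End OneLattice.

Section TwoLattices.
Variables (a b : 'rV[int]_d).
Variables (A : lattice_quotient res pi (L a)) (B : lattice_quotient res pi (L b)).

(** In the two bases multiplication by pi^n is diagonal with entries pi^(n - (a k - b k)), and
    positive powers vanish in the residue field. As n need not be minimal, the projection may be
    zero. *)
Lemma induced_map_coord (n : int) y : (forall k, a 0 k - b 0 k <= n) ->
  induced_map n A B (quot_coord A y) =
  quot_coord B (coord_proj kappa [set k | a 0 k - b 0 k == n]%SET y).
Proof.
move=> abn; have [c ->] := row_res y; rewrite -quot_map_basis_sum.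
have [res_surj res_ker] := hres.
rewrite induced_mapE //; last exact: mem_basis_sum; last first.
- by rewrite dilate_apartment_le.
- exact: is_lattice_apartment.
have -> : pi%:F ^ n *: basis_sum a c =
    basis_sum b (fun k => pi ^+ absz (n - (a 0 k - b 0 k))%R * c k).
  rewrite -[LHS](mulmxKV e_unit) -[RHS](mulmxKV e_unit); congr (_ *m e).
  apply/rowP => k; rewrite -scalemxAl mxE !basis_sum_coord tofracM tofracXn.
  rewrite mulrA -expfzDr // mulrA exprnP -expfzDr //.
  by congr (_ ^ _ * _); have := abn k; lia.
rewrite quot_map_basis_sum; congr (quot_coord B _); apply/rowP => k.
rewrite coord_projE inE !mxE rmorphM rmorphXn /=.
have -> : res pi = 0 by apply/res_ker; exists 1; rewrite mulr1.
have := abn k; case: eqP => [<-|abk] h.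
  by rewrite subrr expr0 mul1r.
by rewrite expr0n (_ : absz _ == 0%N = false) ?mul0r //; lia.
Qed.

End TwoLattices.

End QuotientCoordinates.

(** * Affine transformations and double cosets *)

Section AffineWeylGroup.
Variable d : nat.
Implicit Types (s : 'S_d) (z : 'rV[int]_d).

Lemma affine_transformationE s z (x : 'rV[int]_d) k :
  affine_transformation s z x 0 k = x 0 ((s^-1)%g k) + z 0 k.
Proof. by rewrite !mxE. Qed.

Lemma affine_transformation_comp s z s' z' :
  affine_transformation s z \o affine_transformation s' z' =
  affine_transformation (s' * s)%g (\row_k z' 0 ((s^-1)%g k) + z).
Proof.
apply/funext => x; apply/rowP => k.
by rewrite /= !affine_transformationE ?mxE invMg permM addrA.
Qed.

Lemma affine_transformationK s z :
  affine_transformation (s^-1)%g (- \row_k z 0 (s k)) \o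
  affine_transformation s z = id.
Proof.
apply/funext => x; apply/rowP => k.
by rewrite /= !affine_transformationE ?mxE invgK permK addrK.
Qed.

Lemma affine_transformationVK s z :
  affine_transformation s z \o
  affine_transformation (s^-1)%g (- \row_k z 0 (s k)) = id.
Proof.
apply/funext => x; apply/rowP => k.
by rewrite /= !affine_transformationE ?mxE invgK permKV addrNK.
Qed.

Lemma sum_perm_row s z : \sum_k z 0 (s k) = \sum_k z 0 k.
Proof. by rewrite [RHS](reindex_inj (@perm_inj _ s)). Qed.

Lemma sum_affine_transformation s z (x : 'rV[int]_d) :
  \sum_k affine_transformation s z x 0 k - \sum_k x 0 k = \sum_k z 0 k.
Proof.
under eq_bigr do rewrite affine_transformationE.
by rewrite big_split /= sum_perm_row addrAC subrr add0r.
Qed.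

Variables (V : finType) (a : V -> 'rV[int]_d) (sigma : {set V}).
Local Notation W := (weyl_fixer a sigma).

Lemma weyl_fixerM w w' : W w -> W w' -> W (w \o w').
Proof.
move=> [[s [z [-> z0]]] wa] [[s' [z' [-> z'0]]] w'a]; split.
  rewrite affine_transformation_comp; eexists _, _; split; first reflexivity.
  under eq_bigr do rewrite !mxE.
  by rewrite big_split /= sum_perm_row z'0 z0 addr0.
by move=> v vs; rewrite /= w'a // wa.
Qed.

Lemma weyl_fixerV w : W w -> exists w', [/\ W w', w' \o w = id & w \o w' = id].
Proof.
move=> [[s [z [wE z0]]] wa].
exists (affine_transformation (s^-1)%g (- \row_k z 0 (s k))).
have wK := affine_transformationK s z.
rewrite wE; split=> //; last exact: affine_transformationVK.
split; last by move=> v vs; rewrite -[in LHS](wa v vs) wE; apply: (congr1 (@^~ (a v)) wK).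
eexists _, _; split; first reflexivity.
under eq_bigr do rewrite !mxE.
by rewrite sumrN sum_perm_row z0 oppr0.
Qed.

(** Agreement on the points a v suffices: u = h'^-1 w h fixes them and has translation sum 0, as the
    sums of h and h' agree. Hence u lies in W and w h = h' u. *)
Lemma double_coset_eq s z s' z' w :
    let h := affine_transformation s z in let h' := affine_transformation s' z' in
    \sum_k z 0 k = \sum_k z' 0 k -> W w ->
    (forall v, v \in sigma -> w (h (a v)) = h' (a v)) ->
  double_coset W h = double_coset W h'.
Proof.
move=> h h' zz' Ww wh.
have [h'V h'VE] : exists h'V, h'V = affine_transformation (s'^-1)%g (- \row_k z' 0 (s' k)).
  by eexists.
have h'K : h'V \o h' = id by rewrite h'VE; apply: affine_transformationK.
have h'VK : h' \o h'V = id by rewrite h'VE; apply: affine_transformationVK.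
pose u := h'V \o (w \o h).
have h'u : h' \o u = w \o h by rewrite /u compA h'VK.
have Wu : W u.
  split; last first.
    by move=> v vs; rewrite /u /= wh //; apply: (congr1 (@^~ (a v)) h'K).
  have [[sw [zw [wE zw0]]] _] := Ww.
  rewrite /u h'VE wE /h !affine_transformation_comp.
  eexists _, _; split; first reflexivity.
  under eq_bigr do rewrite !mxE.
  rewrite !big_split /= sumrN !sum_perm_row zw0 addr0.
  have -> : \sum_k z 0 ((sw^-1)%g ((s'^-1)^-1%g k)) = \sum_k z 0 k.
    have := sum_perm_row (s'^-1)^-1%g (\row_k z 0 ((sw^-1)%g k)).
    under eq_bigr do rewrite mxE.
    move=> ->; under eq_bigr do rewrite mxE.
    exact: sum_perm_row.
  by rewrite zz' subrr.
have [w' [Ww' w'w ww']] := weyl_fixerV Ww.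
have [u' [Wu' u'u uu']] := weyl_fixerV Wu.
have hE : h = w' \o h' \o u by rewrite -compA h'u compA w'w.
have h'E : h' = w \o h \o u' by rewrite -h'u -compA uu'.
apply/seteqP; split=> _ [w1 Ww1 [w2 Ww2 <-]].
  exists (w1 \o w'); first exact: weyl_fixerM.
  by exists (u \o w2); [exact: weyl_fixerM|rewrite [in RHS]hE].
exists (w1 \o w); first exact: weyl_fixerM.
by exists (u' \o w2); [exact: weyl_fixerM|rewrite [in RHS]h'E].
Qed.

End AffineWeylGroup.

(** * Comparison of Bruhat strata and rank vectors *)

Section BruhatRank.
Variables (R : idomainType) (pi : R) (kappa : fieldType).
Variables (res : {rmorphism R -> kappa}) (d r : nat).
Variables (e : 'M[{fraction R}]_d) (V : finType) (a : V -> 'rV[int]_d).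
Local Notation L := (fun v => apartment_lattice pi e (a v)).
Variable Lbar : forall v, lattice_quotient res pi (L v).
Hypothesis pi_neq0 : pi != 0.
Hypothesis pi_exp_ge0 : forall z : int, integral (pi%:F ^ z) -> 0 <= z.
Hypothesis hres : residue_map pi res.
Hypothesis d_gt0 : (0 < d)%N.
Hypothesis e_unit : e \in unitmx.
Hypothesis class_inj : injective (fun v => homothety_class (L v)).
Implicit Types (E : forall v, {vspace Lbar v}) (tau : {set V}).

Let piF0 : pi%:F != 0. Proof. by rewrite tofrac_eq0. Qed.

Definition coords E v : {vspace 'rV[kappa]_d} := coord_space (E v).

Lemma exists_surviving u v : exists k, k \in surviving a u v.
Proof.
have [k _ kmax] := @arg_maxP _ _ _ (Ordinal d_gt0) predT
  (fun k => a u 0 k - a v 0 k) isT.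
by exists k; apply/survivingP => l; apply: kmax.
Qed.

Lemma min_exponent_surviving u v k : k \in surviving a u v ->
  min_exponent pi (L u) (L v) = a u 0 k - a v 0 k.
Proof. by move=> /survivingP; apply: min_exponentE. Qed.

Lemma transition_coord u v y :
  transition Lbar u v (quot_coord (Lbar u) y) =
  quot_coord (Lbar v) (coord_proj kappa (surviving a u v) y).
Proof.
have [k ku] := exists_surviving u v.
rewrite /transition (min_exponent_surviving ku).
rewrite (induced_map_coord pi_neq0 pi_exp_ge0 hres e_unit); last exact/survivingP.
congr (quot_coord _ (coord_proj _ _ _)); apply/setP => l.
by rewrite (surviving_eq _ ku) inE.
Qed.

Lemma img_transition E u v :
  (transition Lbar u v @: E u =
   quot_coord (Lbar v) @: (coord_proj kappa (surviving a u v) @: coords E u))%VS.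
Proof.
rewrite -[in LHS](coord_spaceK pi_neq0 e_unit (E u)) -!limg_comp.
apply: eq_in_limg => y _.
by rewrite !comp_lfunE transition_coord.
Qed.

Lemma dim_quot_coord v (U : {vspace 'rV[kappa]_d}) :
  \dim (quot_coord (Lbar v) @: U) = \dim U.
Proof.
rewrite limg_dim_eq // (eqP (quot_coord_inj pi_neq0 hres e_unit (Lbar v))).
exact: capv0.
Qed.

Lemma rank_vector_coord E u v :
  rank_vector E u v = \dim (coord_proj kappa (surviving a u v) @: coords E u).
Proof. by rewrite /rank_vector img_transition dim_quot_coord. Qed.

Lemma dim_coords E v : \dim (coords E v) = \dim (E v).
Proof. exact: (dim_coord_space pi_neq0 hres e_unit). Qed.

Lemma dim_linked E v : linked_grassmannian0 Lbar r E -> \dim (coords E v) = r.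
Proof. by rewrite dim_coords; case=> dimE _; apply: dimE. Qed.

Lemma transition_sub E u v :
  (transition Lbar u v @: E u <= E v)%VS =
  (coord_proj kappa (surviving a u v) @: coords E u <= coords E v)%VS.
Proof.
rewrite img_transition; apply/subvP/subvP => h y.
  by move=> yE; rewrite mem_coord_space; apply: h; apply: memv_img.
by move=> /memv_imgP[z /h zE ->]; rewrite -mem_coord_space.
Qed.

(** A power of pi that is not minimal induces the zero map, so only the minimal exponents impose a
    condition. *)
Lemma linked_grassmannianP E :
  linked_grassmannian0 Lbar r E <->
  dim_vector_const r E /\ forall u v, (transition Lbar u v @: E u <= E v)%VS.
Proof.
split=> -[dimE h]; split=> // u v.
  apply: h; have [k ku] := exists_surviving u v.
  rewrite (min_exponent_surviving ku) (dilate_apartment_le pi_neq0 pi_exp_ge0 e_unit).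
  exact/survivingP.
move=> n; rewrite (dilate_apartment_le pi_neq0 pi_exp_ge0 e_unit) => nP.
apply/subvP => _ /memv_imgP[z zE ->].
have [y yE ->] : exists2 y, y \in coords E u & z = quot_coord (Lbar u) y.
  apply/memv_imgP; by rewrite /coords (coord_spaceK pi_neq0 e_unit).
rewrite (induced_map_coord pi_neq0 pi_exp_ge0 hres e_unit) //.
have [/existsP[k /eqP kn]|/existsPn none] := boolP [exists k, a u 0 k - a v 0 k == n].
  have ku : k \in surviving a u v by apply/survivingP => l; rewrite kn.
  rewrite (_ : [set _ | _]%SET = surviving a u v).
    rewrite -transition_coord; apply: subvP (h u v) _ _; rewrite memv_img //.
    by rewrite -mem_coord_space.
  by apply/setP => l; rewrite (surviving_eq _ ku) inE kn.
rewrite [X in quot_coord _ X](_ : _ = 0) ?linear0 ?mem0v //.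
by apply/rowP => k; rewrite coord_projE inE (negbTE (none k)) mxE.
Qed.

Lemma path_map_coord u p y :
  Defs.path_map Lbar u p (quot_coord (Lbar u) y) =
  quot_coord (Lbar (last u p))
    (\row_k if path (fun x x' => k \in surviving a x x') u p then y 0 k else 0).
Proof.
elim: p u y => [|w p IHp] u y /=.
  by rewrite id_lfunE; congr (quot_coord _ _); apply/rowP => k; rewrite mxE.
rewrite comp_lfunE transition_coord IHp; congr (quot_coord _ _).
apply/rowP => k; rewrite !mxE coord_projE.
by case: (k \in surviving a u w); rewrite //= if_same.
Qed.

(* Along a path on which the coordinate [k] survives, this decreases by the
   length of the quotient of two consecutive lattices. *)
Definition coord_depth k v : int := \sum_l (a v 0 k - a v 0 l).

(** Equality would make a u - a v constant, and the two classes would coincide. *)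
Lemma coord_depth_lt u v k : u != v -> k \in surviving a u v ->
  coord_depth k v < coord_depth k u.
Proof.
move=> uv /survivingP ku.
have [/forallP h|/forallPn[l nl]] :=
  boolP [forall l, a u 0 l - a v 0 l == a u 0 k - a v 0 k].
  case/eqP: uv; apply: class_inj.
  by apply: (homothety_class_apartment pi_neq0 e_unit) => l; apply/eqP/h.
rewrite /coord_depth (bigD1 l) //= [X in _ < X](bigD1 l) //=.
apply: ltr_leD; first by have := ku l; lia.
by apply: ler_sum => m _; have := ku m; lia.
Qed.

Lemma coord_depth_path k u p :
  path (fun x x' => x != x') u p -> path (fun x x' => k \in surviving a x x') u p ->
  coord_depth k (last u p) <= coord_depth k u ?= iff (p == [::]).
Proof.
elim: p u => [|w p IHp] u /=; first by split; rewrite ?lexx ?eqxx.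
move=> /andP[uw pne] /andP[ku kp]; have lt := coord_depth_lt uw ku.
have [le _] := IHp w pne kp; split; first exact: le_trans le (ltW lt).
by apply/negbTE; rewrite lt_eqF //; apply: le_lt_trans le lt.
Qed.

Lemma path_map_sub E k (M : int) u p :
    (forall x x', x != x' -> k \in surviving a x x' ->
      coord_depth k x - coord_depth k x' <= M ->
      (transition Lbar x x' @: E x <= E x')%VS) ->
    path (fun x x' => x != x') u p -> path (fun x x' => k \in surviving a x x') u p ->
    coord_depth k u - coord_depth k (last u p) <= M ->
  (Defs.path_map Lbar u p @: E u <= E (last u p))%VS.
Proof.
move=> h; elim: p u => [|w p IHp] u /=; first by rewrite lim1g.
move=> /andP[uw pne] /andP[ku kp] uM; have lt := coord_depth_lt uw ku.
have [le _] := coord_depth_path pne kp.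
rewrite limg_comp; apply: subv_trans (IHp w pne kp _).
  by apply/limgS/h => //; apply: le_trans uM; rewrite lerD2l lerN2.
by apply: le_trans uM; rewrite lerD2r ltW.
Qed.

(** When (x, x') is not an arrow, its map factors through a path of length at least 2. A coordinate
    surviving from x to x' survives along the whole path, so every step has a smaller drop of
    [coord_depth]. *)
Lemma quiver_grassmannianE :
  quiver_grassmannian Lbar r = linked_grassmannian0 Lbar r.
Proof.
apply/seteqP; split=> E; last first.
  by move=> /linked_grassmannianP[dimE h]; split=> // u v _; apply: h.
move=> [dimE h]; apply/linked_grassmannianP; split=> // u v.
have [k ku] := exists_surviving u v.
suff main (n : nat) x x' : x != x' -> k \in surviving a x x' ->
    coord_depth k x - coord_depth k x' <= n%:Z ->
    (transition Lbar x x' @: E x <= E x')%VS.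
  have [->|uv] := eqVneq u v.
    rewrite transition_sub surviving_refl; apply/subvP => _ /memv_imgP[y yE ->].
    rewrite (_ : coord_proj _ _ _ = y) //; apply/rowP => l.
    by rewrite coord_projE inE.
  apply: (main (absz (coord_depth k u - coord_depth k v)%R)) => //; lia.
elim: n x x' => [|n IHn] x x' xx' kx xn.
  by have := coord_depth_lt xx' kx; lia.
have [ar|nar] := pselect (quiver_arrow Lbar x x'); first exact: h.
have [p [p2 pne x'E pE]] : exists p : seq V,
    [/\ (2 <= size p)%N, path (fun x y => x != y) x p, x' = last x p &
        Defs.path_map Lbar x p = transition Lbar x (last x p)].
  by apply: contrapT => np; apply: nar; split.
rewrite x'E in xx' kx xn *; rewrite -pE.
(* Both sides of the factorization are evaluated at the unit vector of k. *)
have kp : path (fun y y' => k \in surviving a y y') x p.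
  have := path_map_coord x p (delta_mx 0 k); rewrite pE transition_coord.
  move/(lker0P (quot_coord_inj pi_neq0 hres e_unit _))/rowP/(_ k).
  rewrite coord_projE kx !mxE !eqxx; case: ifP => // _ /eqP.
  by rewrite oner_eq0.
case: p p2 pne kp {x'E pE xx' kx} xn => [|w [|w' p]] // _.
move=> /= /andP[xw pne] /andP[kx kp] xn.
have lt := coord_depth_lt xw kx.
have [le eq] := @coord_depth_path k w (w' :: p) pne kp.
have lt' : coord_depth k (last w (w' :: p)) < coord_depth k w by rewrite lt_neqAle eq le.
have n1 : n.+1%:Z = n%:Z + 1 by rewrite -addn1 PoszD.
have lt1 : coord_depth k x - coord_depth k w <= n%:Z.
  rewrite -ltzD1 -n1; apply: lt_le_trans xn.
  by rewrite ltrD2l ltrN2.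
have lt2 : coord_depth k w - coord_depth k (last w (w' :: p)) <= n%:Z.
  rewrite -ltzD1 -n1.
  by apply: lt_le_trans xn; rewrite ltrD2r.
rewrite limg_comp; apply: subv_trans (@path_map_sub E k n%:Z w (w' :: p) IHn pne kp lt2).
by apply: limgS; apply: IHn.
Qed.

Lemma adjacent_apartment u w (c : int) : u != w ->
    (forall k, 0 <= a u 0 k + c - a w 0 k <= 1) ->
  adjacentb pi L u w.
Proof.
move=> uw cP; apply/asboolP; split.
  by move=> /class_inj/eqP; rewrite (negbTE uw).
exists (dilate (pi%:F ^ (- c)) (L u)), (L w); split.
- by apply: homothety_class_dilate; rewrite expfz_neq0.
- exact: homothety_class_refl.
- rewrite -{1}[pi%:F]expr1z !(dilate_apartment pi_neq0 e_unit).
  rewrite (apartment_lattice_le pi_neq0 pi_exp_ge0 e_unit) => k.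
  by rewrite !shift_constE; have := cP k; lia.
rewrite (dilate_apartment pi_neq0 e_unit).
rewrite (apartment_lattice_le pi_neq0 pi_exp_ge0 e_unit) => k.
by rewrite shift_constE; have := cP k; lia.
Qed.

Local Notation J := (maximal_simplex pi L).
Local Notation Zd := 'rV[int]_d.
Local Notation t := (ps_var kappa).

Hypothesis adapted : adapted_representatives pi L.

Lemma simplex_neq0 (tau : J) : val tau != finset.set0.
Proof.
have [v0 [s [vs _ _]]] := adapted tau; apply/set0Pn; exists v0.
by rewrite -mem_enum -(perm_mem vs) inE eqxx.
Qed.

(** The inclusions of an adapted ordering, closed up by the one of the last lattice into pi^-1 times
    the first, squeeze all coordinate differences between 0 and 1. *)
Lemma simplex_near_chain (tau : J) : near_chain a (val tau).
Proof.
have [v0 [s [vs pth lastL]]] := adapted tau.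
have leE := apartment_lattice_le pi_neq0 pi_exp_ge0 e_unit.
have {}lastL k : a (last v0 s) 0 k <= a v0 0 k + 1.
  have := lastL; rewrite -exprN1 (dilate_apartment pi_neq0 e_unit) leE => /(_ k).
  by rewrite shift_constE opprK.
have srt i j k : (i <= j)%N -> (j < size (v0 :: s))%N ->
    a (nth v0 (v0 :: s) i) 0 k <= a (nth v0 (v0 :: s) j) 0 k.
  move=> ij js; suff /asboolP/leE : `[< L (nth v0 (v0 :: s) i) `<=` L (nth v0 (v0 :: s) j) >].
    by [].
  apply: (@sorted_leq_nth _ (fun u v => `[< L u `<=` L v >])) => //.
  - move=> x y z /asboolP yx /asboolP xz; apply/asboolP; exact: subset_trans yx xz.
  - by move=> x; apply/asboolP.
  - by rewrite inE; apply: leq_ltn_trans js.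
have key u v : u \in v0 :: s -> v \in v0 :: s ->
    (index u (v0 :: s) <= index v (v0 :: s))%N ->
    forall k, 0 <= a v 0 k - a u 0 k <= 1.
  move=> us vs' uv k.
  have := srt _ _ k uv; rewrite index_mem vs' !nth_index // => /(_ isT) h1.
  have := srt 0%N (index u (v0 :: s)) k isT; rewrite index_mem us nth_index //= => /(_ isT) h2.
  have := srt (index v (v0 :: s)) (size s) k; rewrite nth_index //.
  rewrite (_ : nth v0 (v0 :: s) (size s) = last v0 s); last exact: (nth_last v0 (v0 :: s)).
  rewrite -ltnS -[(size s).+1]/(size (v0 :: s)) index_mem vs' ltnSn => /(_ isT isT) h3.
  by have := lastL k; lia.
have mem x : x \in val tau -> x \in v0 :: s by rewrite (perm_mem vs) mem_enum.
move=> u v /mem us /mem vs'.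
case/orP: (leq_total (index u (v0 :: s)) (index v (v0 :: s))) => uv.
  by left; apply: key.
by right=> k; have := key v u vs' us uv k; lia.
Qed.

Variable Gamma : set (set (set 'rV[{fraction R}]_d)).
Hypothesis hGamma : convex_lattice_configuration Gamma.
Hypothesis Gamma_range : Gamma = range (fun v => homothety_class (L v)).

(* [w] is the class of the intersection of [L v] with the multiple of [L u] just
   above the largest one contained in [L v]. *)
Lemma exists_adjacent u v : exists w (tau : J),
  [/\ u \in val tau, w \in val tau & surviving a u w = surviving a u v].
Proof.
have [k ku] := exists_surviving u v; set n := a u 0 k - a v 0 k.
have [_ _ _ cvx] := hGamma.
have Gv x : Gamma (homothety_class (L x)) by rewrite Gamma_range; exists x.
have : Gamma (homothety_class (dilate (pi%:F ^ (n - 1)) (L u) `&` L v)).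
  apply: (cvx _ _ _ _ (Gv u) (Gv v)); last exact: homothety_class_refl.
  by apply: homothety_class_dilate; rewrite expfz_neq0.
rewrite (dilate_apartment pi_neq0 e_unit) (apartment_latticeI pi_neq0 e_unit).
rewrite Gamma_range => -[w _ wE].
have wb := homothety_class_apartment_inj pi_neq0 pi_exp_ge0 e_unit wE.
have {}wb l m : a w 0 l - Num.min (a u 0 l - (n - 1)) (a v 0 l) =
    a w 0 m - Num.min (a u 0 m - (n - 1)) (a v 0 m).
  by have := wb l m; rewrite !mxE.
have /survivingP kmax := ku.
have survE : surviving a u w = surviving a u v.
  apply/setP => l; rewrite (surviving_eq _ ku).
  apply/survivingP/eqP => [lmax|lk m].
    by have := lmax k; have := wb l k; have := kmax l; rewrite /n; lia.
  by have := wb l m; have := kmax m; have := kmax l; rewrite /n in lk *; lia.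
(* The intersection has exponents a u l - n at surviving l and a u l - (n - 1) at the others; [c]
   accounts for this and for the homothety from the intersection to a w. *)
pose c := a w 0 k - Num.min (a u 0 k - (n - 1)) (a v 0 k) - n + 1.
have uw l : 0 <= a u 0 l + c - a w 0 l <= 1.
  by rewrite /c; have := wb k l; have := kmax l; rewrite /n; lia.
have splx : is_simplex pi L [set u; w]%SET.
  apply/forall_inP => x xuw; apply/forall_inP => y yuw; apply/implyP => xy.
  move: xuw yuw xy => /set2P[]-> /set2P[]->; rewrite ?eqxx // => xy.
    exact: (adjacent_apartment xy uw).
  by apply: (adjacent_apartment (c := 1 - c) xy) => l; have := uw l; lia.
have [B Bmax /fintype.subsetP Buw] := maxset_exists splx.
exists w, (exist _ B Bmax); split=> //; apply: Buw; by rewrite !inE eqxx ?orbT.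
Qed.

Lemma linked_on_coords E tau :
  linked_grassmannian0 Lbar r E -> linked_on a tau (coords E).
Proof.
by move=> /linked_grassmannianP[_ h] u v _ _; rewrite -transition_sub.
Qed.

Lemma Lambda_preimageE v (U : {vspace Lbar v}) :
  Lambda_preimage U = lift_space (a v) (coord_space U).
Proof.
have sumE (c : 'I_d -> powerSeries kappa) k :
    (\sum_k (c k)%:F *: scaled_basis t 1%:M (a v) k) 0 k =
    t%:F ^ (- a v 0 k) * (c k)%:F.
  have := basis_sum_coord t (unitmx1 _ d) (a v) c k.
  by rewrite invmx1 mulmx1.
apply/seteqP; split=> [_ [c /= cU <-]|x [c xc]].
  exists (\row_k c k); first by move=> k; rewrite sumE mxE.
  rewrite mem_coord_space quot_coordE.
  by under eq_bigr do rewrite !mxE.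
rewrite mem_coord_space quot_coordE => cU; exists (fun k => c 0 k).
  by move: cU; under eq_bigr do rewrite !mxE.
by apply/rowP => k; rewrite sumE xc.
Qed.

Definition in_orbit E tau (b : V -> Zd) := exists2 g : 'M_d, stabilizer a tau g &
  forall v, v \in tau ->
    dilate t%:F^-1 (lift_space (a v) (coords E v)) = translate g (Lambda (b v)).

(** All members of the left coset agree on the vertices of the simplex, so the representative h j
    may stand for any of them. *)
Lemma bruhat_stratumP x (h : J -> Zd -> Zd) E :
    (forall j, x j = left_coset (h j) (weyl_fixer a (val j))) ->
  bruhat_stratum Lbar r x E <->
  linked_grassmannian0 Lbar r E /\
  forall j : J, in_orbit E (val j) (fun v => h j (a v)).
Proof.
move=> xh; split=> -[lnk xE]; split=> // j.
  have [h' [g [+ gP gE]]] := xE j; rewrite xh => -[w [_ wa] h'E].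
  exists g => // v vj; have := gE v vj.
  by rewrite Lambda_preimageE -h'E /= wa.
have [g gP gE] := xE j; exists (h j), g; split=> //.
  rewrite xh; exists id => //; split=> //; exists 1%g, 0; split.
    apply/funext => y; apply/rowP => k.
    by rewrite affine_transformationE invg1 perm1 mxE addr0.
  by rewrite big1 // => k _; rewrite mxE.
by move=> v vj; rewrite Lambda_preimageE gE.
Qed.

Let tF0 : t%:F^-1 != 0 :> {fraction (powerSeries kappa)}.
Proof. by rewrite invr_neq0 // tofrac_eq0 ps_var_neq0. Qed.

Lemma in_orbit_rank E E' tau b u v : in_orbit E tau b -> in_orbit E' tau b ->
    u \in tau -> v \in tau ->
  rank_vector E u v = rank_vector E' u v.
Proof.
move=> [g gP gE] [g' g'P g'E] utau vtau; rewrite !rank_vector_coord.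
apply: (stabilizer_rank (p := invmx g *m g') _ utau vtau).
  exact: stabilizerM (stabilizerV gP) g'P.
apply: (dilate_inj tF0); rewrite -translate_dilate -translateM gE //.
by rewrite translateK ?g'E //; apply: stabilizer_unit gP.
Qed.

(** Equal ranks give E' a frame with the pivots of E, so both lie in the orbit of a v shifted by
    these pivots. *)
Lemma in_orbit_equal_ranks E E' (j : J) b :
    linked_grassmannian0 Lbar r E -> linked_grassmannian0 Lbar r E' ->
    rank_vector E = rank_vector E' ->
  in_orbit E (val j) b -> in_orbit E' (val j) b.
Proof.
move=> lnk lnk' rkE [g gP gE].
have chn := @simplex_near_chain j; have j0 := simplex_neq0 j.
have dimE v : v \in val j -> \dim (coords E v) = \dim (coords E' v).
  by move=> _; rewrite !dim_linked.
have rankE : {in val j &, forall u v,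
    \dim (coord_proj kappa (surviving a u v) @: coords E u) =
    \dim (coord_proj kappa (surviving a u v) @: coords E' u)}.
  by move=> u v _ _; rewrite -!rank_vector_coord rkE.
have lo := @linked_on_coords E (val j) lnk; have lo' := @linked_on_coords E' (val j) lnk'.
have [g1 g1P g1E] := frame_orbit d_gt0 j0 (pivots_frame chn j0 lo).
have [g2 g2P g2E] :=
  frame_orbit d_gt0 j0 (equal_ranks_frame chn lo lo' dimE rankE j0).
(* From b to E by [g], back to the shifted lattices by [g1], and on to E' by [g2]. *)
exists (g *m invmx g1 *m g2).
  by apply: stabilizerM g2P; apply: stabilizerM gP (stabilizerV g1P).
move=> v vj; rewrite g2E // -!translateM -gE // g1E // translateK //.
exact: stabilizer_unit g1P.
Qed.

(** Shifting by the pivots raises each coordinate sum by r and leaves a near chain, hence comes from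
    one affine transformation. *)
Lemma exists_orbit E (j : J) : linked_grassmannian0 Lbar r E ->
  exists (s : 'S_d) (z : Zd), let h := affine_transformation s z in
  [/\ \sum_k z 0 k = r%:Z, in_orbit E (val j) (fun v => h (a v)) &
      forall v, v \in val j -> forall k, a v 0 k <= h (a v) 0 k <= a v 0 k + 1].
Proof.
move=> lnk; have chn := @simplex_near_chain j; have j0 := simplex_neq0 j.
have lo := @linked_on_coords E (val j) lnk.
have [g gP gE] := frame_orbit d_gt0 j0 (pivots_frame chn j0 lo).
set Jp := pivots _ _ _ in gE.
have sumE v : \sum_k shift_on a Jp v 0 k - \sum_k a v 0 k = r%:Z.
  under eq_bigr do rewrite shift_onE.
  rewrite big_split /= addrAC subrr add0r -card_sum_int card_pivotsE //.
  by rewrite dim_linked.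
have [s [z szE]] := near_chain_affine chn (pivots_near_chain chn lo)
  (fun v _ => sumE v).
exists s, z => h; split.
- have /set0Pn[v vj] := j0.
  by rewrite -(sum_affine_transformation s z (a v)) -szE // sumE.
- by exists g => // v vj; rewrite gE // szE.
by move=> v vj k; rewrite /h -szE // shift_onE; case: (k \in _); lia.
Qed.

(** The element g g'^-1 fixes Lambda (a v) and carries Lambda (b v) to Lambda (b' v) for v in
    sigma. *)
Lemma in_orbit_compat E tau tau' sigma b b' : sigma != finset.set0 ->
    sigma \subset tau -> sigma \subset tau' ->
    in_orbit E tau b -> in_orbit E tau' b' ->
    (forall v, v \in sigma -> \sum_k b v 0 k = \sum_k b' v 0 k) ->
  exists (s : 'S_d) (z : Zd), \sum_k z 0 k = 0 /\ forall v, v \in sigma ->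
    affine_transformation s z (a v) = a v /\
    affine_transformation s z (b v) = b' v.
Proof.
move=> s0 /fintype.subsetP st /fintype.subsetP st' [g gP gE] [g' g'P g'E] bb'.
apply: (stabilizer_weyl (p := g *m invmx g')) => //.
  apply: stabilizerM; last apply: stabilizerV.
    by case: gP => g1 ga; split=> // v /st/ga.
  by case: g'P => g1 ga; split=> // v /st'/ga.
move=> v vs; rewrite -translateM -gE ?st // g'E ?st' // translateK //.
exact: stabilizer_unit g'P.
Qed.

Lemma exists_stratum E : linked_grassmannian0 Lbar r E ->
  exists2 x, admissible_collection pi e a r x & bruhat_stratum Lbar r x E.
Proof.
move=> lnk.
have /choice[s sP] j := exists_orbit j lnk.
have /choice[z szP] := sP.
pose h j := affine_transformation (s j) (z j).
exists (fun j => left_coset (h j) (weyl_fixer a (val j))); last first.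
  apply/(@bruhat_stratumP _ h) => //; split=> // j.
  by have [] := szP j.
exists h; split=> [j|j v vj|j j'] //; first by split=> //; exists (s j), (z j).
  have [zr _ hb] := szP j; split; first exact: hb.
  by rewrite sum_affine_transformation.
have [zr jE _] := szP j; have [zr' j'E _] := szP j'.
have zz' : \sum_k z j 0 k = \sum_k z j' 0 k by rewrite zr zr'.
(* For disjoint simplices the fixer is all of W_a, and equality of the translation sums suffices. *)
have [s0|s0] := eqVneq (val j :&: val j')%SET finset.set0.
  move=> W; apply: (@double_coset_eq _ _ _ _ _ _ _ _ id) => //; last first.
    by move=> v; rewrite s0 inE.
  split=> //; exists 1%g, 0; split.
    apply/funext => y; apply/rowP => k.
    by rewrite affine_transformationE invg1 perm1 mxE addr0.
  by rewrite big1 // => k _; rewrite mxE.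
have [|sw [zw [zw0 wP]]] :=
  in_orbit_compat s0 (finset.subsetIl _ _) (finset.subsetIr _ _) jE j'E.
  move=> v _; apply/eqP; rewrite -(inj_eq (subIr (\sum_k a v 0 k))).
  by rewrite !sum_affine_transformation zz'.
move=> W; apply: (@double_coset_eq _ _ _ _ _ _ _ _ (affine_transformation sw zw)) => //.
  by split=> [|v vs]; [exists sw, zw|have [] := wP v vs].
by move=> v vs; have [] := wP v vs.
Qed.

Lemma bruhat_stratum_linked x E :
  bruhat_stratum Lbar r x E -> linked_grassmannian0 Lbar r E.
Proof. by case. Qed.

(** Each pair u, v is replaced by a pair u, w inside one simplex with the same surviving
    coordinates. *)
Lemma bruhat_stratum_rank x E E' : admissible_collection pi e a r x ->
    bruhat_stratum Lbar r x E -> bruhat_stratum Lbar r x E' ->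
  rank_vector E = rank_vector E'.
Proof.
move=> [h [hx _ _]].
have xh j : x j = left_coset (h j) (weyl_fixer a (val j)) by have [] := hx j.
move=> /(bruhat_stratumP _ xh)[_ xE] /(bruhat_stratumP _ xh)[_ xE'].
apply/funext => u; apply/funext => v.
have [w [j [uj wj wv]]] := exists_adjacent u v.
rewrite !rank_vector_coord -wv -!rank_vector_coord.
exact: in_orbit_rank (xE j) (xE' j) uj wj.
Qed.

Lemma equal_ranks_bruhat_stratum x E E' : admissible_collection pi e a r x ->
    bruhat_stratum Lbar r x E -> linked_grassmannian0 Lbar r E' ->
    rank_vector E = rank_vector E' ->
  bruhat_stratum Lbar r x E'.
Proof.
move=> [h [hx _ _]].
have xh j : x j = left_coset (h j) (weyl_fixer a (val j)) by have [] := hx j.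
move=> /(bruhat_stratumP _ xh)[lnk xE] lnk' rk.
apply/(bruhat_stratumP _ xh); split=> // j.
exact: in_orbit_equal_ranks (xE j).
Qed.

End BruhatRank.

Theorem lemma3p17
  (R : idomainType) (pi : R) (hR : dvr_with_uniformizer pi)
  (kappa : closedFieldType) (res : {rmorphism R -> kappa})
  (hres : residue_map pi res)
  (d r : nat) (r_gt0 : (0 < r)%N) (r_lt_d : (r < d)%N)
  (Gamma : set (set (set 'rV[{fraction R}]_d)))
  (hGamma : convex_lattice_configuration Gamma)
  (e : 'M[{fraction R}]_d) (he : e \in unitmx) (hap : in_apartment pi Gamma e)
  (V : finType) (a : V -> 'rV[int]_d)
  (ha_inj : injective (fun v => homothety_class (apartment_lattice pi e (a v))))
  (ha_range : Gamma = range (fun v => homothety_class (apartment_lattice pi e (a v))))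
  (ha : adapted_representatives pi (fun v => apartment_lattice pi e (a v)))
  (Lbar : forall v, lattice_quotient res pi (apartment_lattice pi e (a v))) :
  [/\ forall x, admissible_collection pi e a r x ->
        forall E E', bruhat_stratum Lbar r x E -> bruhat_stratum Lbar r x E' ->
          rank_vector E = rank_vector E',
      forall x y, admissible_collection pi e a r x ->
        admissible_collection pi e a r y ->
        bruhat_stratum Lbar r x <> bruhat_stratum Lbar r y ->
        forall E E', bruhat_stratum Lbar r x E -> bruhat_stratum Lbar r y E' ->
          rank_vector E <> rank_vector E' &
      [set S | S !=set0 /\
         exists2 x, admissible_collection pi e a r x & S = bruhat_stratum Lbar r x] =
      [set S | S !=set0 /\
         exists rho, S = [set E | quiver_grassmannian Lbar r E /\ rank_vector E = rho]]].
Proof.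
have [pi0 _] := hR; have piX := dvr_uniformizer_exp hR.
have d0 : (0 < d)%N by apply: leq_ltn_trans r_lt_d.
have rank_const := @bruhat_stratum_rank _ _ _ _ _ r _ _ _ Lbar pi0 piX hres d0 he
  ha_inj _ hGamma ha_range.
have stratum_rank := @equal_ranks_bruhat_stratum _ _ _ _ _ r _ _ _ Lbar pi0 piX hres
  d0 he ha.
have QG := quiver_grassmannianE r Lbar pi0 piX hres d0 he ha_inj.
(* A nonempty stratum is a whole fiber of the rank vector. The last two assertions are read off
   this, the third also using that every point lies in a stratum. *)
have fiber x E : admissible_collection pi e a r x -> bruhat_stratum Lbar r x E ->
    bruhat_stratum Lbar r x =
    [set E' | quiver_grassmannian Lbar r E' /\ rank_vector E' = rank_vector E].
  move=> xadm xE; rewrite QG.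
  apply/seteqP; split=> [E' xE'|E' [lnk' rk]].
    by split; [exact: bruhat_stratum_linked xE'|exact: rank_const xE' xE].
  exact: stratum_rank xadm xE lnk' (esym rk).
split.
- by move=> x xadm E E'; apply: rank_const.
- move=> x y xadm yadm xy E E' xE yE' rk; apply: xy.
  by rewrite (fiber x E) // (fiber y E') // rk.
apply/seteqP; split=> S [[E SE]].
  move=> [x xadm Sx]; split; first by exists E.
  by exists (rank_vector E); rewrite Sx; apply: fiber; rewrite -?Sx.
move=> [rho Srho]; split; first by exists E.
move: SE; rewrite Srho => -[qE <-]; move: (qE); rewrite QG => lnk.
have [x xadm xE] := exists_stratum pi0 piX hres d0 he ha lnk.
by exists x; rewrite // (fiber x E) ?QG.
Qed.
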